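(* Let $A$ be a polynomial ring in finitely many variables over a field $k$, and let $I$ be a nonzero proper monomial ideal of $A$. Then $\partial^*(I^{(n)})\subseteq I^{(n-1)}$ for all $n\ge 1$. Therefore, the filtration $\{I^{(n)}\}_{n\ge 0}$ is Tor-vanishing, i.e. for all $n\ge 1$ and all $i\ge 0$ the map $\operatorname{Tor}_i^A(k,I^{(n)})\to \operatorname{Tor}_i^A(k,I^{(n-1)})$ induced by the inclusion $I^{(n)}\subseteq I^{(n-1)}$ is zero.
   Context: $k$ is regarded as the $A$-module $A/\mathfrak m$, with $\mathfrak m$ the ideal generated by the variables. For a monomial ideal $Q$ of $A$, $\partial^*(Q)$ denotes the ideal generated by all elements of the form $f/x$, where $f$ is a minimal monomial generator of $Q$ and $x$ is a variable dividing $f$. For an ideal $Q$ of a Noetherian ring $S$ and $n\ge1$, the symbolic power is $Q^{(n)}=S\cap\bigcap_{P\in\operatorname{Min}(Q)}Q^nS_P$, where $\operatorname{Min}(Q)$ is the set of minimal primes of $Q$, and $Q^{(0)}=S$. *)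

(* Defs.v *)
From HB Require Import structures.
From mathcomp Require Import all_boot all_algebra.
From mathcomp Require Import ring_quotient fraction boolp.
From mathcomp Require Import freeg mpoly.

Set Implicit Arguments.
Unset Strict Implicit.
Unset Printing Implicit Defensive.

Import GRing.Theory.
Local Open Scope ring_scope.
Local Open Scope quotient_scope.

(* Submodules are boolean predicates, made from Prop by the classical
   reflection [`[< _ >]]; an ideal of R is a submodule of the regular
   module R^o (so the unit ideal is allowed, unlike with [idealr]). *)
Notation ideal R := (submodClosed (GRing.regular R)).

Section Span.
Variables (R : nzRingType) (V : lmodType R) (X : V -> Prop).

Definition span : {pred V} := fun v =>
  `[< exists2 s : seq (R * V),
        forall p, p \in s -> X p.2 & v = \sum_(p <- s) p.1 *: p.2 >].

Lemma span_closed : submod_closed span.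
Proof.
split=> [|a u v]; first by apply/asboolP; exists [::]; rewrite ?big_nil.
move=> /asboolP[s sX ->] /asboolP[t tX ->]; apply/asboolP.
exists ([seq (a * p.1, p.2) | p <- s] ++ t).
  move=> p; rewrite mem_cat => /orP[/mapP[q qs ->]|]; [exact: (sX q) | exact: tX].
rewrite big_cat big_map scaler_sumr; congr (_ + _).
by apply: eq_bigr => p _; rewrite scalerA.
Qed.

HB.instance Definition _ := GRing.isSubmodClosed.Build R V span span_closed.

Lemma mem_span x : X x -> x \in span.
Proof.
move=> Xx; apply/asboolP; exists [:: (1, x)]; last by rewrite big_seq1 scale1r.
by move=> p; rewrite inE => /eqP->.
Qed.

Lemma span_sub (S : submodClosed V) :
  (forall x, X x -> x \in S) -> {subset span <= S}.
Proof.
move=> XS v /asboolP[s sX ->]; rewrite big_seq; apply: rpred_sum => p ps.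
exact/rpredZ/XS/sX.
Qed.
End Span.

Section Submodule.
Variables (R : nzRingType) (V : lmodType R).

Definition submod (S : submodClosed V) := {x : V | x \in S}.

HB.instance Definition _ S := SubChoice.on (submod S).
HB.instance Definition _ S := [SubChoice_isSubLmodule of submod S by <:].

Section Inclusion.
Variables (S T : submodClosed V) (sST : {subset S <= T}).

Definition submod_incl (x : submod S) : submod T :=
  exist _ (val x) (sST (valP x)).

Lemma submod_incl_linear : linear submod_incl.
Proof.
move=> a x y; apply: val_inj; rewrite [RHS]linearP.
exact: (linearP (val : submod S -> V)).
Qed.

HB.instance Definition _ :=
  GRing.isLinear.Build R (submod S) (submod T) *:%R submod_incl
    submod_incl_linear.
End Inclusion.
End Submodule.

Section QuotientModule.
Variables (R : nzRingType) (V : lmodType R) (S : submodClosed V).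

(* [submodClosed] does not inherit from [zmodClosed]. *)
Definition submod_zmod : {pred V} := S.

Lemma submod_zmod_closed : zmod_closed submod_zmod.
Proof. exact: GRing.submod_closedB (GRing.submodClosedP S). Qed.

HB.instance Definition _ :=
  GRing.isZmodClosed.Build V submod_zmod submod_zmod_closed.

Definition quotmod : Type := Quotient.quot submod_zmod.

HB.instance Definition _ := GRing.Zmodule.on quotmod.

Definition quotmod_pi (v : V) : quotmod := \pi_(Quotient.quot submod_zmod) v.

Lemma quotmod_piE u v : (quotmod_pi u == quotmod_pi v) = (u - v \in S).
Proof. exact: esym (Quotient.idealrBE submod_zmod u v). Qed.

Lemma quotmod_pi_eq0 u : (quotmod_pi u == 0) = (u \in S).
Proof.
have -> : 0 = quotmod_pi 0 :> quotmod by rewrite /quotmod_pi piE.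
by rewrite quotmod_piE subr0.
Qed.

Lemma quotmod_piD : {morph quotmod_pi : u v / u + v}.
Proof. by move=> u v; rewrite /quotmod_pi piE. Qed.

Definition quotmod_repr (x : quotmod) : V := repr (x : Quotient.quot submod_zmod).

Lemma quotmod_reprK : cancel quotmod_repr quotmod_pi.
Proof. by move=> x; apply: reprK. Qed.

Definition quotmod_scale a (x : quotmod) := quotmod_pi (a *: quotmod_repr x).

Lemma quotmod_scale_pi a v : quotmod_scale a (quotmod_pi v) = quotmod_pi (a *: v).
Proof.
apply/eqP; rewrite quotmod_piE -scalerBr rpredZ // -quotmod_piE.
by rewrite quotmod_reprK.
Qed.

Fact quotmod_scaleA a b x :
  quotmod_scale a (quotmod_scale b x) = quotmod_scale (a * b) x.
Proof. by rewrite -[x]quotmod_reprK !quotmod_scale_pi scalerA. Qed.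

Fact quotmod_scale1 : left_id 1 quotmod_scale.
Proof. by move=> x; rewrite -[x]quotmod_reprK quotmod_scale_pi scale1r. Qed.

Fact quotmod_scaleDr : right_distributive quotmod_scale +%R.
Proof.
move=> a x y; rewrite -[x]quotmod_reprK -[y]quotmod_reprK.
by rewrite -quotmod_piD !quotmod_scale_pi -quotmod_piD scalerDr.
Qed.

Fact quotmod_scaleDl x : {morph quotmod_scale^~ x : a b / a + b}.
Proof.
move=> a b; rewrite -[x]quotmod_reprK.
by rewrite !quotmod_scale_pi -quotmod_piD scalerDl.
Qed.

HB.instance Definition _ := GRing.Zmodule_isLmodule.Build R quotmod
  quotmod_scaleA quotmod_scale1 quotmod_scaleDr quotmod_scaleDl.

Lemma quotmod_pi_linear : linear quotmod_pi.
Proof. by move=> a u v; rewrite quotmod_piD -quotmod_scale_pi. Qed.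

HB.instance Definition _ :=
  GRing.isLinear.Build R V quotmod *:%R quotmod_pi quotmod_pi_linear.


Section Lift.
Variables (W : lmodType R) (f : {linear V -> W}).

Definition quotmod_lift of {in S, forall x, f x = 0} :=
  fun x : quotmod => f (quotmod_repr x).

Variable f0 : {in S, forall x, f x = 0}.

Lemma quotmod_lift_pi v : quotmod_lift f0 (quotmod_pi v) = f v.
Proof.
apply/eqP; rewrite -subr_eq0 /quotmod_lift -raddfB; apply/eqP/f0.
by rewrite -quotmod_piE quotmod_reprK.
Qed.

Lemma quotmod_lift_linear : linear (quotmod_lift f0).
Proof.
move=> a x y; rewrite -[x]quotmod_reprK -[y]quotmod_reprK.
by rewrite -linearP !quotmod_lift_pi linearP.
Qed.

HB.instance Definition _ :=
  GRing.isLinear.Build R quotmod W *:%R (quotmod_lift f0) quotmod_lift_linear.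
End Lift.
End QuotientModule.
Arguments quotmod_lift : simpl never.

Section KernelImage.
Variables (R : nzRingType) (V W : lmodType R) (f : {linear V -> W}).

Definition kernel : {pred V} := fun x => f x == 0.

Lemma kernelE x : (x \in kernel) = (f x == 0). Proof. by []. Qed.

Lemma kernel_closed : submod_closed kernel.
Proof.
split=> [|a x y]; rewrite !kernelE ?linear0 //.
by move=> /eqP fx /eqP fy; rewrite linearP fx fy scaler0 addr0.
Qed.

HB.instance Definition _ :=
  GRing.isSubmodClosed.Build R V kernel kernel_closed.

Definition image : {pred W} := fun y => `[< exists x, f x = y >].

Lemma image_closed : submod_closed image.
Proof.
split=> [|a x y]; first by apply/asboolP; exists 0; rewrite linear0.
move=> /asboolP[u <-] /asboolP[v <-]; apply/asboolP.
by exists (a *: u + v); rewrite linearP.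
Qed.

HB.instance Definition _ :=
  GRing.isSubmodClosed.Build R W image image_closed.
End KernelImage.

Section Tensor.
Variables (R : comNzRingType) (M N : lmodType R).
Local Notation free := {freeg (M * N)%type / R}.

Inductive tensor_relator : free -> Prop :=
| TensorLinearl a x x' y :
    tensor_relator (<< (a *: x + x', y) >> - (a *: << (x, y) >> + << (x', y) >>))
| TensorLinearr a x y y' :
    tensor_relator (<< (x, a *: y + y') >> - (a *: << (x, y) >> + << (x, y') >>)).

Definition tensor : lmodType R := quotmod (span tensor_relator).

Definition tens (x : M) (y : N) : tensor := quotmod_pi _ << (x, y) >>.

Lemma tens_linearl y : linear (tens^~ y).
Proof.
move=> a x x'; rewrite /tens -linearP; apply/eqP.
rewrite quotmod_piE; apply: mem_span; exact: TensorLinearl.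
Qed.

Lemma tens_linearr x : linear (tens x).
Proof.
move=> a y y'; rewrite /tens -linearP; apply/eqP.
rewrite quotmod_piE; apply: mem_span; exact: TensorLinearr.
Qed.
End Tensor.

Section FreeLift.
Variables (R : nzRingType) (T : choiceType) (W : lmodType R) (h : T -> W).

Lemma fglift_linear : linear (fglift h : {freeg T / R} -> W).
Proof.
pose hB := lift_is_additive h.
have hD : {morph fglift h : x y / x + y}.
  have h0 : fglift h 0 = 0 by rewrite -(subrr 0) hB subrr.
  have hN x : fglift h (- x) = - fglift h x by rewrite -[- x]sub0r hB h0 sub0r.
  by move=> x y; rewrite -{1}[y]opprK hB hN opprK.
have h0 : fglift h 0 = 0 by rewrite -(subrr 0) hB subrr.
move=> a D E; rewrite hD; congr (_ + _).
have -> : a *: D = \sum_(x <- dom D) << a * coeff x D *g x >> by [].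
have {3}-> : D = \sum_(x <- dom D) << coeff x D *g x >> by rewrite freeg_sumE.
rewrite !(big_morph _ hD h0) scaler_sumr; apply: eq_bigr => x _.
by rewrite !liftU scalerA.
Qed.

HB.instance Definition _ :=
  GRing.isLinear.Build R {freeg T / R} W *:%R (fglift h) fglift_linear.
End FreeLift.

Section TensorMap.
Variables (R : comNzRingType) (M M' N N' : lmodType R).
Variables (f : {linear M -> M'}) (g : {linear N -> N'}).

Definition tensor_map_free : {freeg (M * N)%type / R} -> tensor M' N' :=
  fglift (fun p => tens (f p.1) (g p.2)).

HB.instance Definition _ := GRing.Linear.on tensor_map_free.

Lemma tensor_map_free0 :
  {in span (@tensor_relator R M N), forall t, tensor_map_free t = 0}.
Proof.
move=> t tX; apply/eqP.
apply: (span_sub (S := kernel tensor_map_free)) tX => {}t rel_t.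
rewrite kernelE; apply/eqP.
case: rel_t => [a x x' y|a x y y']; rewrite linearB linearP /=;
  rewrite /tensor_map_free !liftU !scale1r /= linearP.
- by rewrite (tens_linearl _ a) subrr.
- by rewrite (tens_linearr _ a) subrr.
Qed.

Definition tensor_map : {linear tensor M N -> tensor M' N'} :=
  quotmod_lift tensor_map_free0.

Lemma tensor_map_tens x y : tensor_map (tens x y) = tens (f x) (g y).
Proof.
rewrite [LHS](quotmod_lift_pi tensor_map_free0) /= /tensor_map_free liftU.
exact: scale1r.
Qed.
End TensorMap.
Arguments tensor_map : simpl never.

Section TensorTheory.
Variable R : comNzRingType.

Lemma tensor_ind (M N : lmodType R) (Q : tensor M N -> Prop) :
    Q 0 -> (forall x y t, Q t -> Q (tens x y + t)) -> forall t, Q t.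
Proof.
move=> Q0 QD t; rewrite -[t]quotmod_reprK; set D := quotmod_repr t.
rewrite -(freeg_sumE D); elim: (dom D) => [|[x y] s IHs].
  by rewrite big_nil linear0.
rewrite big_cons linearD /=.
suff -> : quotmod_pi (span (@tensor_relator R M N)) << coeff (x, y) D *g (x, y) >>
          = tens (coeff (x, y) D *: x) y by apply: QD.
rewrite -[X in tens X]addr0 tens_linearl.
have -> : tens (0 : M) y = 0.
  by apply: (addIr (tens 0 y)); rewrite -{1}[tens 0 y]scale1r -tens_linearl
    scale1r !add0r.
rewrite addr0 /tens -linearZ; congr quotmod_pi; apply/eqP/freeg_eqP => p.
by rewrite coeffZ !coeffU mul1r.
Qed.

Lemma tensor_map_comp (M M' M'' N N' N'' : lmodType R)
    (f : {linear M -> M'}) (f' : {linear M' -> M''})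
    (g : {linear N -> N'}) (g' : {linear N' -> N''}) t :
  tensor_map f' g' (tensor_map f g t) = tensor_map (f' \o f) (g' \o g) t.
Proof.
elim/tensor_ind: t => [|x y t IHt]; first by rewrite !linear0.
by rewrite !linearD IHt !tensor_map_tens.
Qed.
End TensorTheory.

Definition projective (R : nzRingType) (P : lmodType R) : Prop :=
  forall (X Y : lmodType R) (g : {linear X -> Y}) (f : {linear P -> Y}),
    (forall y, exists x, g x = y) ->
  exists h : {linear P -> X}, forall p, g (h p) = f p.

Record proj_resolution (R : nzRingType) (M : lmodType R) := ProjResolution {
  res_mod :> nat -> lmodType R;
  res_diff : forall i, {linear res_mod i.+1 -> res_mod i};
  res_aug : {linear res_mod 0%N -> M};
  res_projective : forall i, projective (res_mod i);
  res_aug_surj : forall y, exists x, res_aug x = y;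
  res_exact0 : kernel res_aug =i image (res_diff 0%N);
  res_exactS : forall i, kernel (res_diff i) =i image (res_diff i.+1)
}.

(* Tor_i(M, N), computed as the i-th homology of P (x) N for a projective
   resolution P of M. *)
Section Tor.
Variables (R : comNzRingType) (M : lmodType R) (P : proj_resolution M).

Section Module.
Variable N : lmodType R.

Definition tor_diff i : {linear tensor (P i.+1) N -> tensor (P i) N} :=
  tensor_map (res_diff P i) idfun.

Definition tor_cycles i : submodClosed (tensor (P i) N) :=
  match i with
  | 0 => kernel (\0 : {linear tensor (P 0%N) N -> tensor (P 0%N) N})
  | j.+1 => kernel (tor_diff j)
  end.

Definition tor_boundaries i : {pred submod (tor_cycles i)} :=
  fun z => val z \in image (tor_diff i).

Lemma tor_boundaries_closed i : submod_closed (@tor_boundaries i).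
Proof.
split=> [|a x y]; rewrite /tor_boundaries !unfold_in.
  exact: (rpred0 (image (tor_diff i))).
move=> xB yB; rewrite linearP.
exact: (@GRing.submodClosedP _ _ (image (tor_diff i))).2.
Qed.

HB.instance Definition _ i := GRing.isSubmodClosed.Build R
  (submod (tor_cycles i)) (@tor_boundaries i) (@tor_boundaries_closed i).

Definition Tor i : lmodType R := quotmod (@tor_boundaries i).
End Module.

Section Map.
Variables (N N' : lmodType R) (f : {linear N -> N'}).

Lemma tor_diff_natural i t :
  tor_diff N' i (tensor_map idfun f t) = tensor_map idfun f (tor_diff N i t).
Proof.
rewrite /tor_diff !tensor_map_comp.
by elim/tensor_ind: t => [|x y t IHt]; rewrite ?linear0 // !linearD IHt
  !tensor_map_tens.
Qed.

Lemma tor_cycles_map i t :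
  t \in tor_cycles N i -> tensor_map (idfun : P i -> P i) f t \in tor_cycles N' i.
Proof.
case: i t => [|i] t /=; first by move=> _; rewrite kernelE.
rewrite !kernelE => /eqP dt.
by rewrite tor_diff_natural dt linear0.
Qed.

Definition tor_map_cycles i (z : submod (tor_cycles N i)) :
    submod (tor_cycles N' i) :=
  exist _ (tensor_map idfun f (val z)) (tor_cycles_map (valP z)).

Lemma tor_map_cycles_linear i : linear (@tor_map_cycles i).
Proof. by move=> a x y; apply: val_inj; rewrite /= !linearP. Qed.

HB.instance Definition _ i := GRing.isLinear.Build R
  (submod (tor_cycles N i)) (submod (tor_cycles N' i)) *:%R
  (@tor_map_cycles i) (@tor_map_cycles_linear i).

Definition tor_map_pre i : {linear submod (tor_cycles N i) -> Tor N' i} :=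
  quotmod_pi (@tor_boundaries N' i) \o @tor_map_cycles i.

Lemma tor_map_pre0 i : {in @tor_boundaries N i, forall z, tor_map_pre i z = 0}.
Proof.
move=> z /asboolP[y yz]; apply/eqP; rewrite quotmod_pi_eq0; apply/asboolP.
by exists (tensor_map idfun f y); rewrite tor_diff_natural yz.
Qed.

Definition Tor_map i : {linear Tor N i -> Tor N' i} :=
  quotmod_lift (@tor_map_pre0 i).
End Map.
End Tor.

(* M is the first argument of Tor; the choice of a projective resolution of M
   is irrelevant, so all of them are considered. *)
Definition Tor_vanishing (R : comNzRingType) (M : lmodType R)
    (F : nat -> ideal R) : Prop :=
  forall n, (1 <= n)%N -> exists sub : {subset F n <= F n.-1},
  forall (i : nat) (P : proj_resolution M) (x : Tor P (submod (F n)) i),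
    Tor_map P (submod_incl sub) i x = 0.

Section SymbolicPower.
Local Notation "x %:F" := (tofrac x).
Variable R : idomainType.

Fixpoint ideal_pow (Q : ideal R) (n : nat) : {pred R^o} :=
  if n is m.+1 then
    span (fun f : R^o =>
      exists a b : R, [/\ a \in Q, b \in ideal_pow Q m & f = a * b])
  else predT.

Lemma ideal_pow_closed Q n : submod_closed (ideal_pow Q n).
Proof. by case: n => [//|n]; apply: span_closed. Qed.

HB.instance Definition _ Q n := GRing.isSubmodClosed.Build R R^o
  (ideal_pow Q n) (ideal_pow_closed Q n).

Definition minimal_prime (Q : ideal R) (P : prime_idealr R) : Prop :=
  {subset Q <= P} /\
  forall P' : prime_idealr R,
    {subset Q <= P'} -> {subset P' <= P} -> {subset P <= P'}.

(* The localization R_P, inside the fraction field of R. *)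
Definition localization (P : prime_idealr R) (y : {fraction R}) : Prop :=
  exists a s : R, s \notin P /\ y = a%:F / s%:F.

(* The extended ideal J R_P. *)
Definition ideal_ext (P : prime_idealr R) (J : {pred R^o}) (y : {fraction R}) :
    Prop :=
  exists2 s : seq (R * {fraction R}),
    forall p, p \in s -> p.1 \in J /\ localization P p.2
    & y = \sum_(p <- s) p.1%:F * p.2.

Definition symbolic_power (Q : ideal R) (n : nat) : {pred R^o} := fun f =>
  (n == 0%N) ||
  `[< forall P, minimal_prime Q P -> ideal_ext P (ideal_pow Q n) (f : R)%:F >].

Lemma symbolic_power_closed Q n : submod_closed (symbolic_power Q n).
Proof.
rewrite /symbolic_power; split=> [|a f g]; rewrite !unfold_in.
  by apply/orP; right; apply/asboolP => P _; exists [::]; rewrite ?big_nil ?rmorph0.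
case: eqP => //= _ /asboolP fQ /asboolP gQ; apply/asboolP => P minP.
have [s sQ sE] := fQ P minP; have [t tQ tE] := gQ P minP.
exists ([seq (a * p.1, p.2) | p <- s] ++ t).
  move=> p; rewrite mem_cat => /orP[/mapP[q qs ->]|]; last exact: tQ.
  by have [qJ ?] := sQ q qs; split=> //=; apply: (rpredZ (V := R^o)).
rewrite rmorphD rmorphM /= sE tE big_cat big_map mulr_sumr; congr (_ + _).
by apply: eq_bigr => p _; rewrite /= rmorphM mulrA.
Qed.

HB.instance Definition _ Q n := GRing.isSubmodClosed.Build R R^o
  (symbolic_power Q n) (symbolic_power_closed Q n).
End SymbolicPower.

Section MonomialIdeal.
Variables (k : fieldType) (n : nat).
Local Notation A := {mpoly k[n]}.

Definition ideal_of_monomials (G : 'X_{1..n} -> Prop) : ideal A :=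
  span (fun f : A^o => exists2 m, G m & f = 'X_[m]).

Definition monomial_ideal (Q : ideal A) : Prop :=
  exists G, Q =i ideal_of_monomials G.

(* G is a generating set of monomials that is minimal for inclusion. *)
Definition minimal_monomial_generators (Q : ideal A) (G : 'X_{1..n} -> Prop) :
    Prop :=
  Q =i ideal_of_monomials G /\
  forall G' : 'X_{1..n} -> Prop,
    (forall m, G' m -> G m) -> Q =i ideal_of_monomials G' ->
    forall m, G m -> G' m.

Definition dstar (Q : ideal A) : ideal A :=
  span (fun g : A^o => exists G m i,
    [/\ minimal_monomial_generators Q G, G m & (g : A) * 'X_i = 'X_[m]]).

Definition variables_ideal : ideal A :=
  span (fun f : A^o => exists i : 'I_n, f = 'X_i).

Definition residue_module : lmodType A := quotmod variables_ideal.
End MonomialIdeal.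

(* Main.v *)
(* If J and J' are monomial ideals with 1 not in J such that dividing a monomial
   of J by one of its variables always lands in J', then Tor(k, J) -> Tor(k, J')
   is zero: the multigraded contracting homotopy of the Koszul complex divides by
   the first variable of the multidegree, so it maps cycles with coefficients in
   J to chains with coefficients in J'.  For J = I^(n) and J' = I^(n-1) the
   divisibility holds because the minimal primes P of I are generated by
   variables, so that a monomial m is in I^(n) iff, for each P, some u m with u
   a monomial outside P is in I^n, and dividing a product of n monomials of I
   by a variable spoils at most one factor. *)

From HB Require Import structures.
Require Import Defs.
From mathcomp Require Import all_boot all_algebra.
From mathcomp Require Import ring_quotient fraction boolp.
From mathcomp Require Import freeg mpoly.
Import Defs.

Set Implicit Arguments.
Unset Strict Implicit.
Unset Printing Implicit Defensive.

Import GRing.Theory.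
Local Open Scope ring_scope.

(** * Comparison of projective resolutions *)

(** Three obstacles shape the proof. The division homotopy exists only on the Koszul complex,
    whereas [Tor_vanishing] ranges over every projective resolution; vanishing is therefore stated
    on chains and carried from the Koszul resolution to any other by comparison maps. The homotopy
    is additive but not A-linear, so it cannot be tensored with J. Since each Koszul module is free,
    its tensor product with J is identified with the J-valued coefficient functions inside the
    A-valued ones. There the homotopy acts on plain polynomials, and the same formula that proves
    the Koszul complex exact also produces the boundary with coefficients in J'. Finally,
    localization supplies an arbitrary polynomial s outside P with s f in I^n, not a monomial.
    Grading A by the degree in the variables of P and comparing lowest parts extracts a monomial
    multiplier from s. *)

Section Corestriction.
Variables (R : nzRingType) (V W : lmodType R) (S : submodClosed W).
Variables (f : {linear V -> W}) (fS : forall v, f v \in S).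

Definition corestrict v : submod S := exist _ (f v) (fS v).

Lemma corestrict_linear : linear corestrict.
Proof.
move=> a u v; apply: val_inj; rewrite [RHS]linearP.
exact: (linearP f).
Qed.

HB.instance Definition _ :=
  GRing.isLinear.Build R V (submod S) *:%R corestrict corestrict_linear.
End Corestriction.

(** [projective] lifts only through surjections, so both maps are corestricted to the image of [g],
    onto which [g] is surjective. *)
Lemma projective_lift (R : nzRingType) (P X Y : lmodType R)
    (g : {linear X -> Y}) (f : {linear P -> Y}) :
    projective P -> (forall p, exists x, g x = f p) ->
  exists h : {linear P -> X}, forall p, g (h p) = f p.
Proof.
move=> projP fg.
have fS p : f p \in image g by apply/asboolP.
have gS x : g x \in image g by apply/asboolP; exists x.
have [|h gh] := projP _ _ (corestrict gS) (corestrict fS).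
  by move=> [y yS]; have /asboolP[x gx] := yS; exists x; apply: val_inj.
by exists h => p; have /(congr1 val) := gh p.
Qed.

Section DependentRecursion.
Variables (T : nat -> Type) (Q : forall i, T i -> Prop).
Variable S : forall i, T i -> T i.+1 -> Prop.

(** Each step is a mere existence statement, in a type depending on i, so the choice is made on
    elements bundled with a proof of [Q]. [Q] is the invariant that makes the next step possible. *)
Lemma dependent_recursion :
    (exists x, Q (i := 0%N) x) ->
    (forall i (x : T i), Q x -> exists2 y : T i.+1, S x y & Q y) ->
  exists f : forall i, T i, (forall i, S (f i) (f i.+1)) /\ forall i, Q (f i).
Proof.
move=> /cid[x0 Qx0] step.
have stepS i (x : {x : T i | Q x}) :
    {y : {y : T i.+1 | Q y} | S (sval x) (sval y)}.
  by case: x => x Qx /=; have /cid2[y xy Qy] := step i x Qx; exists (exist _ y Qy).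
pose g := fix g i : {x : T i | Q x} :=
  if i is j.+1 then sval (stepS j (g j)) else exist _ x0 Qx0.
exists (fun i => sval (g i)); split=> i; last exact: (svalP (g i)).
exact: (svalP (stepS i (g i))).
Qed.
End DependentRecursion.

Section Comparison.
Variables (R : nzRingType) (M : lmodType R).

Lemma res_diffK (P : proj_resolution M) i x :
  res_diff P i (res_diff P i.+1 x) = 0.
Proof.
by apply/eqP; rewrite -kernelE res_exactS; apply/asboolP; exists x.
Qed.

Lemma res_augK (P : proj_resolution M) x : res_aug P (res_diff P 0%N x) = 0.
Proof.
by apply/eqP; rewrite -kernelE res_exact0; apply/asboolP; exists x.
Qed.

Lemma res_exactS_lift (P : proj_resolution M) i x :
  res_diff P i x = 0 -> exists y, res_diff P i.+1 y = x.
Proof.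
by move=> dx; have := @res_exactS _ _ P i x; rewrite kernelE dx eqxx => /esym/asboolP.
Qed.

Lemma res_exact0_lift (P : proj_resolution M) x :
  res_aug P x = 0 -> exists y, res_diff P 0%N y = x.
Proof.
by move=> dx; have := @res_exact0 _ _ P x; rewrite kernelE dx eqxx => /esym/asboolP.
Qed.

Variables P Q : proj_resolution M.

Lemma comparison_map : exists2 f : forall i, {linear P i -> Q i},
  forall x, res_aug Q (f 0%N x) = res_aug P x
  & forall i x, res_diff Q i (f i.+1 x) = f i (res_diff P i x).
Proof.
(* The invariant is what the next lift needs. The dependent [match] adds compatibility with the
   augmentations in degree 0, the only degree where it makes sense. *)
pose Z i (f : {linear P i -> Q i}) :=
  (forall x, exists y, res_diff Q i y = f (res_diff P i x)) /\
  (match i return {linear P i -> Q i} -> Prop with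
   | 0 => fun f => forall x, res_aug Q (f x) = res_aug P x
   | _.+1 => fun=> True
   end f).
pose S i (f : {linear P i -> Q i}) (g : {linear P i.+1 -> Q i.+1}) :=
  forall x, res_diff Q i (g x) = f (res_diff P i x).
have [||f [fS fZ]] := @dependent_recursion _ Z S.
- have [f f0] := projective_lift (@res_projective _ _ P 0%N)
    (fun p => res_aug_surj Q (res_aug P p)).
  exists f; split=> // x; apply: res_exact0_lift.
  by rewrite f0 res_augK.
- move=> i f [fZ _].
  have [g gf] := projective_lift (f := f \o res_diff P i) (@res_projective _ _ P i.+1) fZ.
  exists g => //; split=> // x; apply: res_exactS_lift.
  by rewrite gf /= res_diffK linear0.
by exists f => //; have [] := fZ 0%N.
Qed.

Lemma comparison_homotopy (f g : forall i, {linear P i -> Q i}) :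
    (forall x, res_aug Q (f 0%N x) = res_aug P x) ->
    (forall x, res_aug Q (g 0%N x) = res_aug P x) ->
    (forall i x, res_diff Q i (f i.+1 x) = f i (res_diff P i x)) ->
    (forall i x, res_diff Q i (g i.+1 x) = g i (res_diff P i x)) ->
  exists2 s : forall i, {linear P i -> Q i.+1},
    forall x, f 0%N x = g 0%N x + res_diff Q 0%N (s 0%N x)
    & forall i x, f i.+1 x = g i.+1 x + res_diff Q i.+1 (s i.+1 x)
                             + s i (res_diff P i x).
Proof.
move=> f0 g0 fd gd.
(* By this invariant f - g - s d is a cycle in degree i + 1, its differential being f d - g d - d s
   d. The invariant persists because the term s d vanishes on boundaries. *)
pose Z i (s : {linear P i -> Q i.+1}) :=
  (forall x, res_diff Q i (s (res_diff P i x)) =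
     f i (res_diff P i x) - g i (res_diff P i x)) /\
  (match i return {linear P i -> Q i.+1} -> Prop with
   | 0 => fun s => forall x, f 0%N x = g 0%N x + res_diff Q 0%N (s x)
   | _.+1 => fun=> True
   end s).
pose S i (s : {linear P i -> Q i.+1}) (t : {linear P i.+1 -> Q i.+2}) :=
  forall x, f i.+1 x = g i.+1 x + res_diff Q i.+1 (t x) + s (res_diff P i x).
have [||s [sS sZ]] := @dependent_recursion _ Z S.
- have [|s s0] := @projective_lift _ _ _ _ (res_diff Q 0) (f 0%N \- g 0%N)
    (@res_projective _ _ P 0%N).
    by move=> x; apply: res_exact0_lift; rewrite /= linearB f0 g0 subrr.
  exists s; split=> x; rewrite s0 //= ; by rewrite [RHS]addrC subrK.
- move=> i s [sZ _].
  have [|t tE] := @projective_lift _ _ _ _ (res_diff Q i.+1)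
    ((f i.+1 \- g i.+1) \- (s \o res_diff P i)) (@res_projective _ _ P i.+1).
    move=> x; apply: res_exactS_lift.
    by rewrite /= 2!linearB fd gd sZ subrr.
  exists t; first by move=> x; rewrite tE /= -addrA subrK [RHS]addrC subrK.
  by split=> // x; rewrite tE /= res_diffK linear0 subr0.
by exists s => //; have [] := sZ 0%N.
Qed.
End Comparison.

(** * Functoriality and universal property of the tensor product *)

Section TensorMapTheory.
Variables (R : comNzRingType) (M M' N N' : lmodType R).

(** The sum is a pointwise hypothesis so that a homotopy identity for [idfun], which is not
    syntactically a sum, can be used directly. *)
Lemma tensor_mapDl (f f1 f2 : {linear M -> M'}) (g : {linear N -> N'}) :
    (forall x, f x = f1 x + f2 x) ->
  forall t, tensor_map f g t = tensor_map f1 g t + tensor_map f2 g t.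
Proof.
move=> fE; elim/tensor_ind=> [|x y t IHt]; first by rewrite !linear0 addr0.
rewrite !linearD IHt !tensor_map_tens fE addrACA; congr (_ + _).
by have := tens_linearl (g y) 1 (f1 x) (f2 x); rewrite !scale1r.
Qed.

Lemma eq_tensor_map (f f' : {linear M -> M'}) (g g' : {linear N -> N'}) :
  f =1 f' -> g =1 g' -> tensor_map f g =1 tensor_map f' g'.
Proof.
move=> fE gE; elim/tensor_ind=> [|x y t IHt]; first by rewrite !linear0.
by rewrite !linearD IHt !tensor_map_tens fE gE.
Qed.
End TensorMapTheory.

Lemma tensor_map_id (R : comNzRingType) (M N : lmodType R) (t : tensor M N) :
  tensor_map idfun idfun t = t.
Proof.
elim/tensor_ind: t => [|x y t IHt]; first by rewrite linear0.
by rewrite linearD IHt tensor_map_tens.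
Qed.

Section TensorLift.
Variables (R : comNzRingType) (M N W : lmodType R) (b : M -> N -> W).
Hypotheses (bl : forall y, linear (b^~ y)) (br : forall x, linear (b x)).

Let b_free : {freeg (M * N)%type / R} -> W := fglift (fun p => b p.1 p.2).

HB.instance Definition _ := GRing.Linear.on b_free.

Lemma tensor_lift_subproof : {in span (@tensor_relator R M N), forall t, b_free t = 0}.
Proof.
move=> t tX; apply/eqP.
apply: (span_sub (S := kernel b_free)) tX => {}t rel_t.
rewrite kernelE; apply/eqP.
case: rel_t => [a x x' y|a x y y']; rewrite linearB linearP /=;
  rewrite /b_free !liftU !scale1r /=.
- by rewrite (bl _ a) subrr.
- by rewrite (br _ a) subrr.
Qed.

Definition tensor_lift : {linear tensor M N -> W} :=
  quotmod_lift tensor_lift_subproof.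

Lemma tensor_lift_tens x y : tensor_lift (tens x y) = b x y.
Proof.
rewrite [LHS](quotmod_lift_pi tensor_lift_subproof) /= /b_free liftU.
exact: scale1r.
Qed.
End TensorLift.

Section TensTheory.
Variables (R : comNzRingType) (M N : lmodType R).

HB.instance Definition _ (x : M) := GRing.isLinear.Build R N (tensor M N) *:%R
  (tens x) (tens_linearr x).

(** A head symbol to carry the linearity of [tens] in its left argument. *)
Definition tens_flip (y : N) (x : M) := tens x y.

HB.instance Definition _ (y : N) := GRing.isLinear.Build R M (tensor M N) *:%R
  (tens_flip y) (tens_linearl y).

Lemma tens0r (x : M) : tens x (0 : N) = 0. Proof. exact: linear0. Qed.

Lemma tens0l (y : N) : tens (0 : M) y = 0.
Proof. exact: (linear0 (tens_flip y)). Qed.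

Lemma tensZ a (x : M) (y : N) : tens (a *: x) y = tens x (a *: y).
Proof. by rewrite [RHS]linearZ; apply: (linearZZ (tens_flip y)). Qed.

Lemma tens_suml (I : finType) (x : I -> M) (y : N) :
  tens (\sum_i x i) y = \sum_i tens (x i) y.
Proof. exact: (linear_sum (tens_flip y)). Qed.

Lemma eq_tensor_linear (W : lmodType R) (u v : {linear tensor M N -> W}) :
  (forall x y, u (tens x y) = v (tens x y)) -> u =1 v.
Proof.
by move=> uv; elim/tensor_ind=> [|x y t IHt]; rewrite ?linear0 // !linearD IHt uv.
Qed.
End TensTheory.

Lemma tor_cycles_diff (R : comNzRingType) (M N : lmodType R)
    (P : proj_resolution M) i (z : tensor (P i.+1) N) :
  z \in tor_cycles P N i.+1 -> tor_diff P N i z = 0.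
Proof. by move/eqP. Qed.

(** * Zero maps on Tor and independence of the resolution *)

Section TorVanishing.
Variables (R : comNzRingType) (M N N' : lmodType R) (f : {linear N -> N'}).

(** Vanishing on Tor before any quotient is taken, the form that chain maps between resolutions can
    transport. *)
Definition tor_null (P : proj_resolution M) i := forall z : tensor (P i) N,
  z \in tor_cycles P N i -> tensor_map idfun f z \in image (tor_diff P N' i).

Lemma tor_null_Tor_map (P : proj_resolution M) i :
  tor_null P i -> forall x : Tor P N i, Tor_map P f i x = 0.
Proof.
move=> nullP x; rewrite -[x]quotmod_reprK.
rewrite [LHS](quotmod_lift_pi (@tor_map_pre0 _ _ P _ _ f i)).
apply/eqP; rewrite quotmod_pi_eq0.
exact/nullP/(valP (quotmod_repr x)).
Qed.

Lemma tor_diff_chain_map (P Q : proj_resolution M)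
    (u : forall i, {linear P i -> Q i}) (L L' : lmodType R) (h : {linear L -> L'}) :
    (forall i x, res_diff Q i (u i.+1 x) = u i (res_diff P i x)) ->
  forall i t, tor_diff Q L' i (tensor_map (u i.+1) h t) =
              tensor_map (u i) h (tor_diff P L i t).
Proof.
move=> ud i t; rewrite /tor_diff !tensor_map_comp.
by apply: eq_tensor_map => // x /=; rewrite ud.
Qed.

(* The comparison maps P -> Q -> P compose to a map homotopic to the identity,
   and tensoring keeps the homotopy. *)
Lemma tor_null_resolution (P Q : proj_resolution M) i :
  tor_null Q i -> tor_null P i.
Proof.
move=> nullQ z zP.
have [u ua ud] := comparison_map P Q.
have [v va vd] := comparison_map Q P.
have [||//||s s0 sS] := @comparison_homotopy _ _ P P (fun i => idfun)
  (fun i => v i \o u i).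
- by [].
- by move=> x /=; rewrite va ua.
- by move=> j x /=; rewrite vd ud.
have uzQ : tensor_map (u i) idfun z \in tor_cycles Q N i.
  case: (i) z zP => [|j] z /=; first by rewrite !kernelE.
  by rewrite !kernelE => /eqP dz; rewrite (tor_diff_chain_map _ ud) dz linear0.
have /asboolP[y yE] := nullQ _ uzQ.
set w := tensor_map idfun f z.
(* Of the homotopy d s + s d, the part s d vanishes on the cycle [w], leaving a boundary. Degree 0
   is treated apart because its homotopy has no s d term. *)
suff [t tE] : exists t, w = tensor_map (v i \o u i) idfun w + tor_diff P N' i t.
  apply/asboolP; exists (tensor_map (v i.+1) idfun y + t).
  rewrite linearD (tor_diff_chain_map _ vd) yE [RHS]tE; congr (_ + _).
  by rewrite !tensor_map_comp; apply: eq_tensor_map.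
case: (i) z zP @w {nullQ uzQ y yE} => [|j] z zP w.
  exists (tensor_map (s 0%N) idfun w).
  rewrite -[LHS]tensor_map_id /tor_diff tensor_map_comp.
  rewrite (@tensor_mapDl _ _ _ _ _ _ (v 0%N \o u 0%N) (res_diff P 0%N \o s 0%N)) //.
have dw : tensor_map (res_diff P j) idfun w = 0.
  have /eqP dz := zP.
  by have := @tor_diff_natural _ _ P _ _ f j z; rewrite dz linear0.
exists (tensor_map (s j.+1) idfun w).
rewrite -[LHS]tensor_map_id /tor_diff tensor_map_comp.
pose h1 : {linear _ -> _} := (v j.+1 \o u j.+1) \+ (res_diff P j.+1 \o s j.+1).
rewrite (@tensor_mapDl _ _ _ _ _ _ h1 (s j \o res_diff P j)) //.
have -> : tensor_map (s j \o res_diff P j) idfun w = 0.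
  rewrite -[RHS](linear0 (tensor_map (s j) idfun)) -dw tensor_map_comp.
  exact: eq_tensor_map.
rewrite addr0 (@tensor_mapDl _ _ _ _ _ h1 (v j.+1 \o u j.+1)
  (res_diff P j.+1 \o s j.+1)) //.
Qed.
End TorVanishing.

(** * The Koszul resolution *)

Section MonomialFilter.
Variables (k : fieldType) (d : nat).
Local Notation A := {mpoly k[d]}.

Lemma mcoeff_suppX (C : pred 'X_{1..d}) (f : A) m :
  \sum_(u <- msupp f | C u) f@_u * (u == m)%:R = if C m then f@_m else 0.
Proof.
case: ifP => Cm.
  rewrite {3}[f]mpolyE raddf_sum /= big_mkcond; apply: eq_bigr => u _.
  rewrite mcoeffZ mcoeffX; case: ifP => // Cu.
  by case: eqP Cu => [->|_ _]; rewrite ?Cm // mulr0.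
by rewrite big1 // => u Cu; case: eqP => [um|_]; [rewrite -um Cu in Cm | rewrite mulr0].
Qed.

Definition mfilter (C : pred 'X_{1..d}) (f : A) : A :=
  \sum_(m <- msupp f | C m) f@_m *: 'X_[m].

Lemma mcoeff_mfilter C f m : (mfilter C f)@_m = if C m then f@_m else 0.
Proof.
rewrite raddf_sum -mcoeff_suppX; apply: eq_bigr => u _.
by rewrite /= mcoeffZ mcoeffX.
Qed.

(** Truncated subtraction makes [m - U_(i)] equal to [m] when x_i does not divide the monomial,
    hence the case distinction. *)
Lemma mcoeffXUM (f : A) (i : 'I_d) m :
  ('X_i * f)@_m = if (0 < m i)%N then f@_(m - U_(i)) else 0.
Proof.
rewrite mulrC; case: ifP => mi.
  have mE : m = (U_(i) + (m - U_(i)))%MM by rewrite addmC submK // lep1mP -lt0n.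
  by rewrite [in LHS]mE mcoeffMX.
apply/eqP; rewrite mcoeff_eq0 (perm_mem (msuppMX _ _)).
apply/negP => /mapP[u _ mE]; move: mi.
by rewrite mE mnmDE mnm1E eqxx.
Qed.

Definition free_below (p : nat) : pred 'X_{1..d} := fun m =>
  [forall q : 'I_d, (q < p)%N ==> (m q == 0%N)].

Lemma free_belowP p (m : 'X_{1..d}) :
  reflect (forall q : 'I_d, q < p -> m q = 0)%N (free_below p m).
Proof.
apply: (iffP forallP) => mp q.
  by move=> qp; have := mp q; rewrite qp => /eqP.
by apply/implyP => qp; apply/eqP/mp.
Qed.

(** Every nonconstant term has exactly one first variable, so the operators [mdivX p] share out the
    terms of f without overlap. *)
Definition mdivX (p : 'I_d) (f : A) : A :=
  \sum_(m <- msupp f | free_below p m && (0 < m p)%N) f@_m *: 'X_[(m - U_(p))%MM].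

Lemma mcoeff_mdivX p f m :
  (mdivX p f)@_m = if free_below p m then f@_(m + U_(p)) else 0.
Proof.
transitivity (\sum_(u <- msupp f | free_below p u && (0 < u p)%N)
  f@_u * (u == m + U_(p))%MM%:R).
  rewrite raddf_sum; apply: eq_bigr => u /andP[_ up] /=.
  rewrite mcoeffZ mcoeffX; congr (_ * _%:R); congr nat_of_bool.
  have uE : (u - U_(p) + U_(p))%MM = u by rewrite submK // lep1mP -lt0n.
  by apply/eqP/eqP => [<-|->]; rewrite ?uE ?addmK.
rewrite (mcoeff_suppX (fun u => free_below p u && (0 < u p)%N)).
congr (if _ then _ else _).
rewrite mnmDE mnm1E eqxx addn1 andbT.
by apply/free_belowP/free_belowP => lm q qp; have := lm q qp; rewrite mnmDE mnm1E;
  case: eqP qp => [->|_ _]; rewrite ?ltnn ?addn0.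
Qed.

Lemma mdivX_is_additive p : {morph mdivX p : f g / f - g}.
Proof.
move=> f g; apply/mpolyP => m; rewrite mcoeffB !mcoeff_mdivX mcoeffB.
by case: ifP => // _; rewrite subrr.
Qed.

HB.instance Definition _ p := GRing.isZmodMorphism.Build A A (mdivX p)
  (mdivX_is_additive p).

Lemma free_below0 m : free_below 0 m. Proof. exact/free_belowP. Qed.

Lemma free_belowS (p : 'I_d) m : free_below p.+1 m = free_below p m && (m p == 0%N).
Proof.
apply/free_belowP/andP => [lm|[/free_belowP lm /eqP mp] q].
  split; last by rewrite lm.
  by apply/free_belowP => q qp; rewrite lm // ltnW.
by rewrite ltnS leq_eqVlt => /predU1P[/val_inj->|/lm].
Qed.

Lemma free_below_subU (p : 'I_d) m : free_below p (m - U_(p))%MM = free_below p m.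
Proof.
by apply/free_belowP/free_belowP => lm q qp; have := lm q qp; rewrite mnmBE mnm1E;
  case: eqP qp => [->|_ _]; rewrite ?ltnn ?subn0.
Qed.

(** A term free of the variables before x_p either lacks x_p too or has it as first variable. This
    is the telescoping step of [sum_mdivX]. *)
Lemma mfilter_free_belowS (p : 'I_d) f :
  mfilter (free_below p) f = mfilter (free_below p.+1) f + 'X_p * mdivX p f.
Proof.
apply/mpolyP => m; rewrite mcoeffD mcoeffXUM mcoeff_mdivX !mcoeff_mfilter.
rewrite free_belowS free_below_subU.
case: (free_below p m) => /=; last by rewrite if_same addr0.
case: posnP => [_|mp]; first by rewrite addr0.
by rewrite add0r submK // lep1mP -lt0n.
Qed.

Lemma sum_mdivX p f : (p <= d)%N ->
  \sum_(j < d | (j < p)%N) 'X_j * mdivX j f = f - mfilter (free_below p) f.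
Proof.
elim: p => [_|p IHp lt_pd].
  rewrite big_pred0 // [X in _ - X](_ : _ = f) ?subrr //.
  by apply/mpolyP => m; rewrite mcoeff_mfilter free_below0.
rewrite (bigD1 (Ordinal lt_pd)) //= (eq_bigl (fun j : 'I_d => (j < p)%N)) => [|j].
  rewrite IHp 1?ltnW // (mfilter_free_belowS (Ordinal lt_pd)) /=.
  by rewrite addrC opprD addrA subrK.
by rewrite ltnS -val_eqE /= ltn_neqAle andbC.
Qed.

(** A later factor x_j does not affect whether x_p is the first variable. With the next two lemmas
    (an earlier factor kills everything, x_p itself is undone up to a filter) this covers every term
    in the homotopy computation. *)
Lemma mdivX_mul_gt (p j : 'I_d) f : (p < j)%N ->
  mdivX p ('X_j * f) = 'X_j * mdivX p f.
Proof.
move=> pj; apply/mpolyP => m; rewrite mcoeff_mdivX !mcoeffXUM mcoeff_mdivX.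
have pNj : (p == j) = false by rewrite -val_eqE ltn_eqF.
have -> : free_below p (m - U_(j))%MM = free_below p m.
  apply/free_belowP/free_belowP => lm q qp; have := lm q qp; rewrite mnmBE mnm1E;
  by case: eqP (ltn_trans qp pj) => [->|_ _]; rewrite ?ltnn ?subn0.
rewrite mnmDE mnm1E pNj addn0; case: ifP => // _; case: ifP => // mj.
congr (_@__); apply/mnmP => q; rewrite mnmBE !mnmDE mnmBE !mnm1E addnBAC //.
by case: eqP => [<-|].
Qed.

Lemma mdivX_mul_lt (p j : 'I_d) f : (j < p)%N -> mdivX p ('X_j * f) = 0.
Proof.
move=> jp; apply/mpolyP => m; rewrite mcoeff_mdivX mcoeffXUM mcoeff0.
case: free_belowP => // lm; rewrite mnmDE mnm1E lm //.
by rewrite -val_eqE /= gtn_eqF.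
Qed.

Lemma mdivX_mul_eq (p : 'I_d) f : mdivX p ('X_p * f) = mfilter (free_below p) f.
Proof.
apply/mpolyP => m; rewrite mcoeff_mdivX mcoeff_mfilter mcoeffXUM.
by rewrite mnmDE mnm1E eqxx addn1 addmK.
Qed.

Lemma free_below_max m : free_below d m = (m == 0%MM).
Proof.
apply/free_belowP/eqP => [lm|-> q _]; last by rewrite mnm0E.
by apply/mnmP => q; rewrite lm // mnm0E.
Qed.

Lemma mfilter_free_below_max f : mfilter (free_below d) f = f@_0 *: 1.
Proof.
apply/mpolyP => m; rewrite mcoeff_mfilter free_below_max mcoeffZ mcoeff1.
by case: eqP => [->|_]; rewrite ?mulr1 ?mulr0.
Qed.
End MonomialFilter.

(** * The Koszul complex and its contraction *)

Section Koszul.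
Variables (k : fieldType) (d : nat).
Local Notation A := {mpoly k[d]}.
Local Notation K := {ffun {set 'I_d} -> A^o}.
Implicit Types (j l p q : 'I_d) (S T : {set 'I_d}).

(** For j outside S, the sign relating the wedge of e_j and e_S to the ordered basis element of j +
    S. *)
Definition koszul_sign j S : A := (-1) ^+ #|[set q in S | (q < j)%N]|.

Lemma koszul_sign_min j S : (forall q, q \in S -> (j <= q)%N) ->
  koszul_sign j S = 1.
Proof.
move=> minj; rewrite /koszul_sign [X in #|pred_of_set X|](_ : _ = set0) ?cards0 //.
apply/setP => q; rewrite !inE; apply/negP => /andP[/minj].
by rewrite leqNgt => /negP.
Qed.

Lemma mdivX_sign p j S (f : A) :
  mdivX p (koszul_sign j S * f) = koszul_sign j S * mdivX p f.
Proof. exact: (raddfMsign (mdivX p)). Qed.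

Lemma koszul_signU l j S : j \notin S ->
  koszul_sign l (j |: S) = if (j < l)%N then - koszul_sign l S else koszul_sign l S.
Proof.
move=> jS; rewrite /koszul_sign; case: ifP => jl.
  have -> : [set q in j |: S | (q < l)%N] = j |: [set q in S | (q < l)%N].
    by apply/setP => q; rewrite !inE andb_orl; case: eqP => [->|//]; rewrite jl.
  by rewrite cardsU1 inE (negPf jS) exprS mulN1r.
congr (_ ^+ _); congr #|pred_of_set _|; apply/setP => q; rewrite !inE.
by case: eqP => [->|//]; rewrite jl (negPf jS).
Qed.

(** [c S] is the coefficient of e_S. All degrees live in one module, so signs and homotopy are
    computed without degree bookkeeping; the formula is the Koszul differential read off
    coefficientwise. *)
Definition koszul_diff (c : K) : K := [ffun S : {set 'I_d} =>
  \sum_(j : 'I_d | j \notin S) koszul_sign j S * ('X_j * (c (j |: S) : A))].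

Lemma koszul_diff_is_linear : linear koszul_diff.
Proof.
move=> a c c'; apply/ffunP => S; rewrite !ffunE scaler_sumr -big_split /=.
apply: eq_bigr => j _; rewrite !ffunE /GRing.scale /= !mulrDr; congr (_ + _).
by rewrite [RHS]mulrCA; congr (_ * _); rewrite [RHS]mulrCA.
Qed.

HB.instance Definition _ := GRing.isLinear.Build A K K *:%R koszul_diff
  koszul_diff_is_linear.

(** The sum is cut into j < l and l < j and the second half re-indexed, so the terms cancel in pairs
    without dividing by 2. *)
Lemma sum_alternating (V : zmodType) (P : pred 'I_d) (a : 'I_d -> 'I_d -> V) :
    (forall j l, P j -> P l -> (j < l)%N -> a j l = - a l j) ->
  \sum_(j | P j) \sum_(l | P l && (l != j)) a j l = 0.
Proof.
move=> alt.
have split_lt j : P j -> \sum_(l | P l && (l != j)) a j l =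
    \sum_(l | P l && (j < l)%N) a j l + \sum_(l | P l && (l < j)%N) a j l.
  move=> _; rewrite (bigID (fun l : 'I_d => (j < l)%N)) /=; congr (_ + _).
    apply: eq_bigl => l; rewrite -andbA; congr (_ && _).
    by rewrite -val_eqE /=; case: ltngtP.
  apply: eq_bigl => l; rewrite -andbA; congr (_ && _).
  by rewrite -val_eqE /=; case: ltngtP.
rewrite (eq_bigr _ split_lt) big_split /=.
rewrite [X in _ + X](exchange_big_dep P) /=; last by move=> j l _ /andP[].
apply/eqP; rewrite addr_eq0 -sumrN; apply/eqP/eq_bigr => j Pj.
rewrite -sumrN; apply: eq_big => l; first by rewrite Pj /=; case: (P l).
by case/andP => Pl jl; apply: alt.
Qed.

Lemma koszul_diffK c : koszul_diff (koszul_diff c) = 0.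
Proof.
apply/ffunP => S; rewrite !ffunE.
pose a j l : A := koszul_sign j S * ('X_j * (koszul_sign l (j |: S) *
  ('X_l * (c (l |: (j |: S)) : A)))).
rewrite -[RHS](@sum_alternating A (fun j => j \notin S) a).
  apply: eq_bigr => j jS; rewrite ffunE !mulr_sumr /=; apply: eq_bigl => l.
  by rewrite !inE negb_or andbC.
move=> j l jS lS jl; rewrite /a !koszul_signU // jl ltnNge (ltnW jl) /= setUCA.
rewrite mulNr !mulrN; congr (- _).
by rewrite ![koszul_sign _ _ * ('X__ * _)]mulrA mulrCA.
Qed.

(* The basis element x^a e_S goes to x^(a - e_p) e_(S + p) if the first variable
   x_p of its multidegree a + 1_S is not in S, and to 0 otherwise. *)
Definition koszul_homotopy (c : K) : K :=
  let hc T : A^o :=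
    if [pick p in T | [forall q in T, (p <= q)%N]] is Some p
    then mdivX p (c (T :\ p) : A) else 0
  in [ffun T : {set 'I_d} => hc T].

Lemma koszul_homotopy0 c : koszul_homotopy c set0 = 0.
Proof. by rewrite ffunE; case: pickP => // p; rewrite inE. Qed.

(** The inserted variable precedes all of S, so e_T is reached only from T minus its least element,
    and no sign appears. *)
Lemma koszul_homotopyE c T p : p \in T -> (forall q, q \in T -> (p <= q)%N) ->
  koszul_homotopy c T = mdivX p (c (T :\ p) : A).
Proof.
move=> pT minp; rewrite ffunE; case: pickP => [r /andP[rT /forall_inP minr]|/(_ p)].
  suff -> : p = r by [].
  by apply: val_inj; apply/eqP; rewrite eqn_leq minp //= minr.
by rewrite pT /= => /forall_inP[]; exact: minp.
Qed.

Lemma set_min S : S = set0 \/ exists2 p, p \in S & forall q, q \in S -> (p <= q)%N.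
Proof.
have [->|/set0Pn[r rS]] := eqVneq S set0; first by left.
right; case: (arg_minnP (fun p : 'I_d => p : nat) rS) => p pS minp.
by exists p.
Qed.

(** Write d and h for differential and homotopy. At the empty set only d h contributes, and gives
    [c set0] minus its constant term. At S with least element p, the j < p in d h give [c S] minus
    its part free of variables before x_p, and j = p in h d gives that part back. The j > p cancel
    between d h and h d, and the j < p in h d vanish. *)
Lemma koszul_homotopyP (c : K) :
  koszul_diff (koszul_homotopy c) + koszul_homotopy (koszul_diff c) =
  c - [ffun S : {set 'I_d} =>
         if S == set0 then mfilter (free_below d) (c set0 : A) else 0].
Proof.
apply/ffunP => S.
have ffD (u v : K) : (u + v) S = u S + v S by rewrite ffunE.
have ffB (u v : K) : (u - v) S = u S - v S by rewrite !ffunE.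
rewrite ffD ffB [X in _ - X]ffunE.
have below j : j \notin S -> (forall q, q \in S -> (j <= q)%N) ->
  koszul_sign j S * ('X_j * (koszul_homotopy c (j |: S) : A)) =
  'X_j * mdivX j (c S : A).
  move=> jS minj; rewrite koszul_sign_min // mul1r (koszul_homotopyE _ (p := j)).
  - by rewrite setU1K.
  - exact: setU11.
  - by move=> q /setU1P[->|/minj].
case: (set_min S) => [S0|[p pS minp]].
  move: below; rewrite S0 => below.
  rewrite koszul_homotopy0 addr0 eqxx -(sum_mdivX _ (leqnn d)) ffunE.
  apply: eq_big => [j|j jS]; first by rewrite inE ltn_ord.
  by rewrite below // => q; rewrite inE.
have -> : (S == set0) = false by apply/eqP => S0; rewrite S0 inE in pS.
rewrite subr0 (koszul_homotopyE _ pS minp) !ffunE.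
(* The minus sign arises because S has one more element before j than [S :\ p] has, namely p. *)
have above j : j \notin S -> (p < j)%N ->
    koszul_sign j S * ('X_j * (koszul_homotopy c (j |: S) : A)) =
    - mdivX p (koszul_sign j (S :\ p) * ('X_j * (c (j |: (S :\ p)) : A))).
  move=> jS pj; rewrite (koszul_homotopyE _ (p := p)); last first.
  - by move=> q /setU1P[->|/minp//]; apply: ltnW.
  - by rewrite inE pS orbT.
  rewrite mdivX_sign mdivX_mul_gt //.
  rewrite -{1}(setD1K pS) koszul_signU ?setD11 // pj mulNr.
  congr (- (_ * (_ * mdivX _ (c _)))).
  apply/setP => q; rewrite !inE; case: (eqVneq q p) => //= ->.
  by rewrite -val_eqE /= ltn_eqF.
rewrite raddf_sum [X in _ + X](bigD1 p) /= ?setD11 //.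
rewrite mdivX_sign mdivX_mul_eq setD1K // koszul_sign_min => [|q /setD1P[_ /minp//]].
rewrite mul1r (bigID (fun j : 'I_d => (j < p)%N)) /= addrACA.
rewrite (eq_bigr (fun j => 'X_j * mdivX j (c S : A))) => [|j /andP[jS jp]]; last first.
  by rewrite below // => q /minp; apply: leq_trans; apply: ltnW.
rewrite (eq_bigl (fun j : 'I_d => (j < p)%N)) => [|j]; last first.
  by case: ltnP => jp; rewrite ?andbF // andbT; apply/negP => /minp; rewrite leqNgt jp.
rewrite sum_mdivX 1?ltnW // subrK -[RHS]addr0; congr (_ + _).
rewrite [X in _ + X](bigID (fun j : 'I_d => (j < p)%N)) /= [X in _ + (X + _)]big1.
  rewrite add0r [X in _ + X](eq_bigl (fun j => (j \notin S) && ~~ (j < p)%N)) => [|j];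
    last first.
    rewrite !inE; case: (eqVneq j p) => [->|]; rewrite ?pS ?andbF //=.
    by rewrite andbT.
  rewrite -big_split big1 //= => j /andP[jS jp].
  rewrite above ?addNr // ltn_neqAle leqNgt jp andbT eq_sym.
  by apply: contraNneq jS => /val_inj->.
by move=> j /andP[_ jp]; rewrite mdivX_sign mdivX_mul_lt // mulr0.
Qed.

End Koszul.

(** * The Koszul complex as a projective resolution of the residue module *)

Section KoszulResolution.
Variables (k : fieldType) (d : nat).
Local Notation A := {mpoly k[d]}.
Local Notation K := {ffun {set 'I_d} -> A^o}.
Implicit Types (j l p q : 'I_d) (S T : {set 'I_d}) (i : nat).

Definition koszul_deg i : {pred K} := fun c =>
  [forall S : {set 'I_d}, (#|S| != i) ==> (c S == 0)].

Lemma koszul_degP i (c : K) :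
  reflect (forall S, #|S| != i -> c S = 0) (c \in koszul_deg i).
Proof.
apply: (iffP forallP) => c0 S.
  by move=> Si; have := c0 S; rewrite Si => /eqP.
by apply/implyP => Si; apply/eqP/c0.
Qed.

Lemma koszul_deg_closed i : submod_closed (koszul_deg i).
Proof.
split=> [|a c c' /koszul_degP c0 /koszul_degP c'0]; apply/koszul_degP => S Si.
  by rewrite ffunE.
by rewrite !ffunE c0 // c'0 // scaler0 addr0.
Qed.

HB.instance Definition _ i := GRing.isSubmodClosed.Build A K (koszul_deg i)
  (koszul_deg_closed i).

Definition koszul_mod i : lmodType A := submod (koszul_deg i).

Lemma koszul_diff_deg i (c : K) : c \in koszul_deg i.+1 -> koszul_diff c \in koszul_deg i.
Proof.
move=> /koszul_degP c0; apply/koszul_degP => S Si; rewrite ffunE big1 // => j jS.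
by rewrite c0 ?mulr0 // cardsU1 jS add1n eqSS.
Qed.

Lemma koszul_diff_deg0 (c : K) : c \in koszul_deg 0 -> koszul_diff c = 0.
Proof.
move=> /koszul_degP c0; apply/ffunP => S; rewrite !ffunE big1 // => j jS.
by rewrite c0 ?mulr0 // cardsU1 jS.
Qed.

Lemma koszul_homotopy_deg i (c : K) :
  c \in koszul_deg i -> koszul_homotopy c \in koszul_deg i.+1.
Proof.
move=> /koszul_degP c0; apply/koszul_degP => T Ti.
have [->|[p pT minp]] := set_min T; first by rewrite koszul_homotopy0.
rewrite (koszul_homotopyE _ pT minp) c0 ?raddf0 //.
by move: Ti; rewrite (cardsD1 p) pT add1n eqSS.
Qed.

(** The homotopy formula on cycles. The explicit primitive matters: exactness needs only its
    existence, but the vanishing on Tor needs control of its coefficients. *)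
Lemma koszul_contract i (c : K) : c \in koszul_deg i -> koszul_diff c = 0 ->
  mfilter (free_below d) (c set0 : A) = 0 -> c = koszul_diff (koszul_homotopy c).
Proof.
move=> ci dc c0; have := koszul_homotopyP c.
rewrite dc; have -> : koszul_homotopy (0 : K) = 0 :> K.
  apply/ffunP => T; have [->|[p pT minp]] := set_min T.
    by rewrite koszul_homotopy0 ffunE.
  by rewrite (koszul_homotopyE _ pT minp) !ffunE raddf0.
rewrite addr0 => ->; rewrite [X in _ - X](_ : _ = 0 :> K) ?subr0 //.
by apply/ffunP => S; rewrite !ffunE c0 if_same.
Qed.

Definition koszul_val i : {linear koszul_mod i -> K} :=
  (val : submod (koszul_deg i) -> K).

Definition koszul_of i (c : K) (ci : c \in koszul_deg i) : koszul_mod i :=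
  exist (fun c => c \in koszul_deg i) c ci.

Lemma koszul_d_subproof i (c : koszul_mod i.+1) :
  (@koszul_diff k d \o koszul_val i.+1) c \in koszul_deg i.
Proof. exact/koszul_diff_deg/(valP c). Qed.

Definition koszul_d i : {linear koszul_mod i.+1 -> koszul_mod i} :=
  corestrict (@koszul_d_subproof i).

(** The size test makes this zero for S of the wrong size, so sums over the basis of degree i can
    range over all subsets. *)
Definition koszul_basis_fun i S : K :=
  [ffun T : {set 'I_d} => if (T == S) && (#|S| == i) then 1 else 0].

Lemma koszul_basis_subproof i S : koszul_basis_fun i S \in koszul_deg i.
Proof.
apply/koszul_degP => T Ti; rewrite ffunE; case: eqP => //= ST.
by rewrite -ST (negPf Ti).
Qed.

Definition koszul_basis i S : koszul_mod i := koszul_of (koszul_basis_subproof i S).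

Lemma koszul_basisE i (c : koszul_mod i) :
  c = \sum_S (koszul_val i c S : A) *: koszul_basis i S.
Proof.
apply: val_inj; rewrite -[LHS]/(koszul_val i c) -[RHS]/(koszul_val i _) linear_sum.
apply/ffunP => T; rewrite sum_ffunE (bigD1 T) //= big1 ?addr0 => [|S ST].
  rewrite !ffunE eqxx /=; case: eqP => [_|/eqP Ti]; first by rewrite [RHS]mulr1.
  by rewrite scaler0; apply/koszul_degP: Ti; apply: (valP c).
by rewrite !ffunE eq_sym (negPf ST) scaler0.
Qed.

Lemma koszul_projective i : projective (koszul_mod i).
Proof.
move=> X Y g f g_onto.
have /choice[x xE] S : exists x, g x = f (koszul_basis i S) by [].
pose h (c : koszul_mod i) := \sum_S (koszul_val i c S : A) *: x S.
have h_lin : linear h.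
  move=> a c c'; rewrite scaler_sumr -big_split; apply: eq_bigr => S _.
  by rewrite linearP !ffunE scalerDl -scalerA.
pose hL := HB.pack_for {linear koszul_mod i -> X} h
  (GRing.isLinear.Build _ _ _ _ h h_lin).
exists hL => c; rewrite [in RHS](koszul_basisE c) !linear_sum.
by apply: eq_bigr => S _; rewrite !linearZ xE.
Qed.

Definition koszul_const (c : koszul_mod 0) : A^o := koszul_val 0 c set0.

Lemma koszul_const_is_linear : linear koszul_const.
Proof. by move=> a c c'; rewrite /koszul_const linearP !ffunE. Qed.

HB.instance Definition _ := GRing.isLinear.Build A (koszul_mod 0) A^o *:%R
  koszul_const koszul_const_is_linear.

Definition koszul_aug : {linear koszul_mod 0 -> residue_module k d} :=
  quotmod_pi (@variables_ideal k d) \o koszul_const.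

Lemma koszul_aug_surj y : exists x, koszul_aug x = y.
Proof.
exists ((quotmod_repr y : A) *: koszul_basis 0 set0).
rewrite -[RHS]quotmod_reprK /=; congr quotmod_pi.
by rewrite linearZ /= /koszul_const /= ffunE eqxx cards0 [LHS]mulr1.
Qed.

Lemma variables_ideal_const0 (f : A) :
  f \in @variables_ideal k d -> mfilter (free_below d) f = 0.
Proof.
move=> /asboolP[s sX ->].
rewrite mfilter_free_below_max raddf_sum big_seq big1 ?scale0r //=.
move=> p /sX[j ->]; rewrite /GRing.scale /= mulrC.
by rewrite mcoeffXUM mnm0E.
Qed.

Lemma koszul_exact0 : kernel koszul_aug =i image (koszul_d 0).
Proof.
move=> c; rewrite kernelE quotmod_pi_eq0; apply/idP/asboolP => [cX|[c' <-]].
  have ci : koszul_val 0 c \in koszul_deg 0 by exact: (valP c).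
  exists (koszul_of (koszul_homotopy_deg ci)); apply: val_inj => /=.
  rewrite -(koszul_contract ci) ?koszul_diff_deg0 //.
  exact: variables_ideal_const0.
rewrite -[X in X \in _]/(koszul_diff (koszul_val 1 c') set0) ffunE.
apply: rpred_sum => j _.
rewrite mulrCA mulrC; apply: (rpredZ (V := A^o)); apply: mem_span; by exists j.
Qed.

Lemma koszul_exactS i : kernel (koszul_d i) =i image (koszul_d i.+1).
Proof.
move=> c; rewrite kernelE; apply/eqP/asboolP => [dc|[c' <-]].
  have ci : koszul_val i.+1 c \in koszul_deg i.+1 by exact: (valP c).
  exists (koszul_of (koszul_homotopy_deg ci)); apply: val_inj => /=.
  rewrite -(koszul_contract ci) //; first exact: (congr1 val dc).
  (* In positive degree the coefficient at the empty set is zero, so the constant-term condition is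
     automatic. *)
  by rewrite (koszul_degP _ _ ci) ?cards0 // mfilter_free_below_max mcoeff0 scale0r.
by apply: val_inj; rewrite /= koszul_diffK.
Qed.

Definition koszul_resolution : proj_resolution (residue_module k d) :=
  ProjResolution koszul_projective koszul_aug_surj koszul_exact0 koszul_exactS.
End KoszulResolution.
Arguments koszul_val {k d} i.

(** * The Koszul complex with coefficients in an ideal *)

Section KoszulTor.
Variables (k : fieldType) (d : nat).
Local Notation A := {mpoly k[d]}.
Local Notation K := {ffun {set 'I_d} -> A^o}.
Implicit Types (j l p q : 'I_d) (S T : {set 'I_d}) (i : nat).

Section Evaluation.
Variable J : ideal A.

Definition submod_val : {linear submod J -> A^o} := (val : submod J -> A^o).

Definition koszul_pairing i (c : koszul_mod k d i) (f : submod J) : K :=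
  (submod_val f : A) *: koszul_val i c.

Lemma koszul_pairing_linearl i f : linear ((@koszul_pairing i)^~ f).
Proof.
by move=> a c c'; rewrite /koszul_pairing linearP scalerDr !scalerA mulrC.
Qed.

Lemma koszul_pairing_linearr i c : linear (@koszul_pairing i c).
Proof.
by move=> a f f'; rewrite /koszul_pairing linearP scalerDl -scalerA.
Qed.

(** Embeds the tensor product into the A-valued Koszul complex, where the non-linear homotopy is
    available; its image is the J-valued functions of degree i. *)
Definition koszul_eval i : {linear tensor (koszul_mod k d i) (submod J) -> K} :=
  tensor_lift (@koszul_pairing_linearl i) (@koszul_pairing_linearr i).

Lemma koszul_eval_tens i c f :
  koszul_eval i (tens c f) = (submod_val f : A) *: koszul_val i c.
Proof. exact: tensor_lift_tens. Qed.

Definition koszul_sum i (F : {set 'I_d} -> submod J) :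
    tensor (koszul_mod k d i) (submod J) := \sum_S tens (koszul_basis k i S) (F S).

Lemma koszul_sumP i (t : tensor (koszul_mod k d i) (submod J)) :
  exists F, t = koszul_sum i F.
Proof.
elim/tensor_ind: t => [|c f t [F ->]].
  by exists (fun=> 0); rewrite /koszul_sum big1 // => S _; rewrite tens0r.
exists (fun S => (koszul_val i c S : A) *: f + F S).
rewrite {1}(koszul_basisE c) tens_suml -big_split; apply: eq_bigr => S _.
by rewrite /= tensZ -linearD.
Qed.

Lemma koszul_eval_sum i F S :
  koszul_eval i (koszul_sum i F) S = if #|S| == i then val (F S) else 0.
Proof.
rewrite linear_sum sum_ffunE (bigD1 S) //= big1 ?addr0 => [|T TS].
  rewrite koszul_eval_tens !ffunE eqxx /=; case: ifP => _; last exact: scaler0.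
  exact: mulr1.
by rewrite koszul_eval_tens !ffunE eq_sym (negPf TS) scaler0.
Qed.

(** Every tensor is a sum of e_S tensored with elements of J, and evaluation at S reads off the
    coefficient; for S of the wrong size the basis vector is already zero. *)
Lemma koszul_eval_inj i : injective (koszul_eval i).
Proof.
apply: raddf_inj => t; have [F ->] := koszul_sumP t => F0.
rewrite /koszul_sum big1 // => S _.
have := congr1 (fun c : K => c S) F0; rewrite koszul_eval_sum ffunE.
have [Si FS0|/negPf Si _] := eqVneq #|S| i.
  have -> : F S = 0 by apply: val_inj.
  by rewrite tens0r.
have -> : koszul_basis k i S = 0.
  by apply: val_inj; apply/ffunP => T; rewrite !ffunE Si andbF.
by rewrite tens0l.
Qed.

Lemma koszul_eval_mem i t S : koszul_eval i t S \in J.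
Proof.
have [F ->] := koszul_sumP t; rewrite koszul_eval_sum.
by case: ifP => _; [exact: (valP (F S)) | exact: rpred0].
Qed.

Lemma koszul_eval_deg i t : koszul_eval i t \in koszul_deg i.
Proof.
have [F ->] := koszul_sumP t; apply/koszul_degP => S Si.
by rewrite koszul_eval_sum (negPf Si).
Qed.

Lemma koszul_eval_surj i (c : K) : c \in koszul_deg i ->
  (forall S, c S \in J) -> exists t, koszul_eval i t = c.
Proof.
move=> /koszul_degP c0 cJ.
exists (koszul_sum i (fun S => exist (fun f => f \in J) (c S) (cJ S))).
apply/ffunP => S; rewrite koszul_eval_sum; case: eqP => //= /eqP Si.
by rewrite c0.
Qed.

Definition koszul_tensor_d i : {linear tensor (koszul_mod k d i.+1) (submod J) ->
    tensor (koszul_mod k d i) (submod J)} := tensor_map (koszul_d k d i) idfun.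

Lemma koszul_eval_diff i t :
  koszul_eval i (koszul_tensor_d i t) = koszul_diff (koszul_eval i.+1 t).
Proof.
pose u : {linear tensor (koszul_mod k d i.+1) (submod J) -> K} :=
  koszul_eval i \o koszul_tensor_d i.
pose v : {linear tensor (koszul_mod k d i.+1) (submod J) -> K} :=
  @koszul_diff k d \o koszul_eval i.+1.
suff E : forall c f, u (tens c f) = v (tens c f).
  exact: (eq_tensor_linear E t).
by move=> c f; rewrite /u /= tensor_map_tens !koszul_eval_tens linearZ.
Qed.
End Evaluation.

Lemma koszul_eval_incl (J J' : ideal A) (sub : {subset J <= J'}) i t :
  koszul_eval J' i (tensor_map idfun (submod_incl sub) t) = koszul_eval J i t.
Proof.
apply: (@eq_tensor_linear _ _ _ _ (koszul_eval J' i \o tensor_map idfun (submod_incl sub))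
  (koszul_eval J i)) => c f.
by rewrite /= tensor_map_tens !koszul_eval_tens.
Qed.

(** The evaluated cycle is the differential of its homotopy, whose coefficients are [mdivX] of
    elements of J, hence in J'. It therefore comes from a tensor over J', and injectivity of
    evaluation pulls the identity back. *)
Lemma koszul_tensor_null (J J' : ideal A) (sub : {subset J <= J'}) i
    (z : tensor (koszul_mod k d i) (submod J)) :
    (forall f : A, f \in J -> f@_0 = 0) ->
    (forall (p : 'I_d) (f : A), f \in J -> mdivX p f \in J') ->
    koszul_diff (koszul_eval J i z) = 0 ->
  exists w, koszul_tensor_d J' i w = tensor_map idfun (submod_incl sub) z.
Proof.
move=> J0 JJ' dz.
have zE := koszul_contract (koszul_eval_deg z) dz.
rewrite mfilter_free_below_max J0 ?koszul_eval_mem // scale0r in zE.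
have [|w wE] := @koszul_eval_surj J' i.+1 _ (koszul_homotopy_deg (koszul_eval_deg z)).
  move=> T; have [->|[p pT minp]] := set_min T.
    by rewrite koszul_homotopy0; exact: rpred0.
  by rewrite (koszul_homotopyE _ pT minp); apply/JJ'/koszul_eval_mem.
exists w.
apply: koszul_eval_inj.
exact: (etrans (koszul_eval_diff w) (etrans (congr1 (@koszul_diff k d) wE)
  (etrans (esym (zE erefl)) (esym (koszul_eval_incl sub z))))).
Qed.

Lemma koszul_cycles0 (J : ideal A) i (z : tensor (koszul_mod k d i.+1) (submod J)) :
  koszul_tensor_d J i z = 0 -> koszul_diff (koszul_eval J i.+1 z) = 0.
Proof.
move=> dz; rewrite -[RHS](linear0 (koszul_eval J i)) -[in RHS]dz.
exact/esym/koszul_eval_diff.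
Qed.

Lemma koszul_tor_null (J J' : ideal A) (sub : {subset J <= J'}) i :
    (forall f : A, f \in J -> f@_0 = 0) ->
    (forall (p : 'I_d) (f : A), f \in J -> mdivX p f \in J') ->
  tor_null (submod_incl sub) (koszul_resolution k d) i.
Proof.
move=> J0 JJ' z zC; apply/asboolP.
apply: (koszul_tensor_null (i := i) sub J0 JJ').
case: i z zC => [|i] z zC; first exact/koszul_diff_deg0/koszul_eval_deg.
exact/koszul_cycles0/(tor_cycles_diff zC).
Qed.
End KoszulTor.

(** * Symbolic powers of monomial ideals *)

Section IdealPower.
Variables (R : idomainType) (I : ideal R).
Implicit Types (a b f : R) (n : nat).

Lemma ideal_powMl n a b : b \in ideal_pow I n -> a * b \in ideal_pow I n.
Proof. exact: (rpredZ (V := R^o)). Qed.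

Lemma ideal_powS n a b : a \in I -> b \in ideal_pow I n -> a * b \in ideal_pow I n.+1.
Proof. by move=> aI bI; apply: mem_span; exists a, b. Qed.

Lemma ideal_powSP n f : f \in ideal_pow I n.+1 ->
  exists2 s : seq (R * R),
    forall p, p \in s -> p.1 \in I /\ p.2 \in ideal_pow I n
    & f = \sum_(p <- s) p.1 * p.2.
Proof.
move=> /asboolP[s]; elim: s f => [|p s IHs] f sX ->.
  by exists [::]; rewrite ?big_nil.
have [q qs|t tI tE] := IHs _ _ erefl; first by apply: sX; rewrite inE qs orbT.
have [a [b [aI bI pE]]] := sX p (mem_head _ _).
exists ((p.1 * a, b) :: t) => [q|]; last first.
  by rewrite !big_cons tE pE /= /GRing.scale /= mulrA.
rewrite inE => /predU1P[->|/tI//]; split=> //.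
exact: (rpredZ (V := R^o)).
Qed.

Lemma ideal_pow_sub_pred n : {subset ideal_pow I n <= ideal_pow I n.-1}.
Proof.
case: n => [//|n] f /=; apply: (span_sub (S := ideal_pow I n)) => _ [a [b [_ bI ->]]].
exact: ideal_powMl.
Qed.

Lemma ideal_pow_sub n : (0 < n)%N -> {subset ideal_pow I n <= I}.
Proof.
case: n => [//|n] _ f; apply: (span_sub (S := I)) => _ [a [b [aI _ ->]]].
by rewrite mulrC; apply: (rpredZ (V := R^o)).
Qed.
End IdealPower.

(** * Symbolic powers without fractions *)

Section SymbolicPower.
Local Notation "x %:F" := (tofrac x).
Variable R : idomainType.
Implicit Types (P : prime_idealr R) (f a b s : R).

(** A finite sum of fractions has a common denominator, which stays outside P because P is prime;
    conversely f = (s f) / s. *)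
Lemma ideal_extP P (J : ideal R) f :
  ideal_ext P J f%:F <-> exists2 s, s \notin P & s * f \in J.
Proof.
have F0 s : s \notin P -> s%:F != 0 :> {fraction R}.
  by rewrite tofrac_eq0; apply: contraNneq => ->; exact: rpred0.
split=> [[r rJ fE]|[s sP sfJ]].
  suff [s [g [sP gJ gE]]] : exists s g : R, [/\ s \notin P, g \in J
      & s%:F * (\sum_(p <- r) p.1%:F * p.2) = g%:F].
    exists s => //; suff -> : s * f = g by [].
    by apply/eqP; rewrite -tofrac_eq rmorphM /= fE gE.
  elim: r rJ {fE} => [|p r IHr] rJ.
    exists 1, 0; split; [by rewrite idealr1 | exact: (rpred0 J) |].
    by rewrite big_nil mulr0 rmorph0.
  have [q qr|s [g [sP gJ gE]]] := IHr; first by apply: rJ; rewrite inE qr orbT.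
  have [pJ [a [t [tP pE]]]] := rJ p (mem_head _ _).
  exists (t * s), (s * a * p.1 + t * g).
  rewrite prime_idealrM negb_or tP sP; split=> //.
    by apply: (rpredD (V := R^o)); apply: (rpredZ (V := R^o)).
  rewrite big_cons mulrDr !rmorphD !rmorphM /= -[X in _ + X]mulrA gE; congr (_ + _).
  have tp : t%:F * p.2 = a%:F by rewrite pE mulrC divfK ?F0.
  by rewrite mulrCA [t%:F * _]mulrC -[X in _ * X]mulrA tp mulrC.
exists [:: (s * f, 1%:F / s%:F)].
  move=> p; rewrite inE => /eqP->; split=> //.
  by exists 1, s.
by rewrite big_seq1 /= rmorphM rmorph1 /= mul1r mulrAC divff ?mul1r ?F0.
Qed.

(** The exponent 0 needs no separate clause here: [ideal_pow Q 0] is the whole ring and s = 1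
    serves. *)
Lemma mem_symbolic_power (Q : ideal R) n f : f \in symbolic_power Q n <->
  forall P, minimal_prime Q P -> exists2 s, s \notin P & s * f \in ideal_pow Q n.
Proof.
rewrite /symbolic_power unfold_in; split=> [|fQ].
  case: eqP => /= [-> _ P _|_ /asboolP fQ P minP].
    by exists 1; rewrite ?idealr1.
  by have /ideal_extP := fQ P minP.
apply/orP; right; apply/asboolP => P minP.
exact/ideal_extP/fQ.
Qed.
End SymbolicPower.

(** * Monomial ideals and their powers *)

Section MonomialClosed.
Variables (k : fieldType) (d : nat).
Local Notation A := {mpoly k[d]}.
Implicit Types (m u : 'X_{1..d}) (i j : 'I_d) (f g s : A).

(** The form of monomiality used from here on: it passes to powers and symbolic powers without
    tracking a generating set. *)
Definition mon_closed (J : {pred A^o}) :=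
  forall f m, f \in J -> m \in msupp f -> ('X_[m] : A) \in J.

Lemma msupp_bigsum (T : eqType) (r : seq T) (F : T -> A) m :
  m \in msupp (\sum_(x <- r) F x) -> exists2 x, x \in r & m \in msupp (F x).
Proof.
elim: r => [|x r IHr]; first by rewrite big_nil msupp0.
rewrite big_cons => /msuppD_le; rewrite mem_cat => /orP[mx|/IHr[y yr my]].
  by exists x; rewrite ?mem_head.
by exists y; rewrite // inE yr orbT.
Qed.

Lemma msuppMP f g m : m \in msupp (f * g) ->
  exists u v, [/\ m = (u + v)%MM, u \in msupp f & v \in msupp g].
Proof. by move=> /msuppM_le /allpairsP[[u v] /= [uf vg ->]]; exists u, v. Qed.

Lemma monomial_ideal_closed (I : ideal A) : monomial_ideal I -> mon_closed I.
Proof.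
move=> [G IG] f m; rewrite !IG => /asboolP[r rG ->] /msupp_bigsum[p pr].
move=> /msuppMP[u [v [-> _]]]; have [w Gw ->] := rG _ pr.
rewrite msuppX inE => /eqP->; rewrite mpolyXD.
by apply: (rpredZ (V := A^o)); apply: mem_span; exists w.
Qed.

Lemma mon_closed_sum (J : submodClosed A^o) (r : seq 'X_{1..d}) (P : pred 'X_{1..d})
    (c : 'X_{1..d} -> k) (g : 'X_{1..d} -> 'X_{1..d}) :
  {in r, forall m, P m -> ('X_[g m] : A) \in J} ->
  (\sum_(m <- r | P m) c m *: 'X_[g m] : A) \in J.
Proof.
move=> rJ; rewrite big_seq_cond; apply: rpred_sum => m /andP[mr Pm].
by rewrite -mul_mpolyC; apply/(rpredZ (V := A^o))/rJ.
Qed.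

Section IdealPower.
Variables (I : ideal A) (monI : mon_closed I).

Lemma mon_closed_ideal_pow n : mon_closed (ideal_pow I n).
Proof.
elim: n => [//|n IHn] f m /ideal_powSP[r rI ->] /msupp_bigsum[p pr].
move=> /msuppMP[u [v [-> up vp]]]; have [p1 p2] := rI _ pr.
rewrite mpolyXD; apply: ideal_powS; first exact: monI up.
exact: IHn vp.
Qed.

(** The monomial occurs in the support of one of the products a b that sum to it, so it splits into
    a monomial of a and one of b. *)
Lemma ideal_powX_split n m : ('X_[m] : A) \in ideal_pow I n.+1 ->
  exists u v, [/\ m = (u + v)%MM, ('X_[u] : A) \in I & ('X_[v] : A) \in ideal_pow I n].
Proof.
have mX : m \in msupp ('X_[m] : A) by rewrite msuppX mem_head.
move=> /ideal_powSP[r rI rE]; move: mX; rewrite rE => /msupp_bigsum[p pr].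
move=> /msuppMP[u [v [-> up vp]]]; have [p1 p2] := rI _ pr.
exists u, v; split=> //; first exact: monI up.
exact: mon_closed_ideal_pow vp.
Qed.

(* Dividing a product of n monomials of I by a variable spoils one factor. *)
Lemma ideal_pow_divX n m j : ('X_[m] : A) \in ideal_pow I n -> (0 < m j)%N ->
  ('X_[(m - U_(j))%MM] : A) \in ideal_pow I n.-1.
Proof.
elim: n m => [//|n IHn] m mI mj /=.
have [u [v [mE uI vI]]] := ideal_powX_split mI.
have split_sub (w : 'X_{1..d}) : (0 < w j)%N -> w = (U_(j) + (w - U_(j)))%MM.
  by move=> wj; rewrite addmC submK // lep1mP -lt0n.
case: (posnP (u j)) => [uj|uj]; last first.
  rewrite mE (split_sub u uj) -addmA addmC addmK mpolyXD.
  exact: ideal_powMl.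
have vj : (0 < v j)%N by move: mj; rewrite mE mnmDE uj.
rewrite mE (split_sub v vj) addmA (addmC u) -addmA addmC addmK mpolyXD.
(* The predecessor truncates at 0: when only the factor u is present, the target is the whole
   ring. *)
case: n IHn vI {mI} => [//|n] IHn vI.
by apply: ideal_powS => //; apply: IHn vI vj.
Qed.
End IdealPower.
End MonomialClosed.

(** * Primes generated by variables *)

Section VariablePrimes.
Variables (k : fieldType) (d : nat).
Local Notation A := {mpoly k[d]}.
Implicit Types (m u v : 'X_{1..d}) (i j : 'I_d) (f g s : A) (F : {set 'I_d}).

Lemma msupp_mfilter (C : pred 'X_{1..d}) f m :
  (m \in msupp (mfilter C f)) = C m && (m \in msupp f).
Proof. by rewrite !mcoeff_msupp mcoeff_mfilter; case: ifP; rewrite ?eqxx. Qed.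

Lemma mfilter_eq0 (C : pred 'X_{1..d}) f :
  (mfilter C f == 0) = all (predC C) (msupp f).
Proof.
apply/eqP/allP => [f0 m mf|fC].
  by apply/negP => Cm; have := msupp_mfilter C f m; rewrite Cm mf f0 msupp0.
apply/mpolyP => m; rewrite mcoeff_mfilter mcoeff0; case: ifP => // Cm.
by apply/eqP; rewrite mcoeff_eq0; apply/negP => /fC /=; rewrite Cm.
Qed.

Lemma mfilterB (C : pred 'X_{1..d}) : {morph mfilter C : f g / f - g : A}.
Proof.
move=> f g; apply/mpolyP => m; rewrite mcoeffB !mcoeff_mfilter mcoeffB.
by case: ifP => // _; rewrite subrr.
Qed.

(** The grading by total degree in the variables of F; the monomials of weight 0 are those outside
    the prime generated by F. *)
Definition set_weight F m : nat := \sum_(i in F) m i.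

Lemma set_weightD F u v : set_weight F (u + v) = (set_weight F u + set_weight F v)%N.
Proof. by rewrite /set_weight -big_split; apply: eq_bigr => i _; rewrite mnmDE. Qed.

Lemma set_weight0 F : set_weight F 0%MM = 0%N.
Proof. by rewrite /set_weight big1 // => i _; rewrite mnm0E. Qed.

Lemma set_weight_eq0 F m : (set_weight F m == 0%N) = [forall i in F, m i == 0%N].
Proof.
rewrite sum_nat_eq0; apply/forall_inP/forall_inP => mF i iF; exact: mF.
Qed.

Definition weight_part F (r : nat) f : A := mfilter (fun m => set_weight F m == r) f.

(** With f_a and g_b the parts of weight a and b, f g - f_a g_b = (f - f_a) g + f_a (g - g_b), and
    both summands have only terms of weight above a + b. *)
Lemma mcoeff_weight_partM F a b f g m :
    (forall u, u \in msupp f -> (a <= set_weight F u)%N) ->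
    (forall v, v \in msupp g -> (b <= set_weight F v)%N) -> set_weight F m = (a + b)%N ->
  (f * g)@_m = (weight_part F a f * weight_part F b g)@_m.
Proof.
move=> fa gb mab; apply/eqP; rewrite -subr_eq0 -mcoeffB.
have -> : f * g - weight_part F a f * weight_part F b g =
    (f - weight_part F a f) * g + weight_part F a f * (g - weight_part F b g).
  by rewrite mulrBl mulrBr addrA subrK.
have gap c h : (forall u, u \in msupp h -> (c <= set_weight F u)%N) ->
    forall u, u \in msupp (h - weight_part F c h) -> (c < set_weight F u)%N.
  move=> hc u; rewrite mcoeff_msupp mcoeffB mcoeff_mfilter.
  case: ifPn => [_|uc]; first by rewrite subrr eqxx.
  by rewrite subr0 -mcoeff_msupp ltn_neqAle eq_sym uc; apply: hc.
rewrite mcoeffD addr_eq0; apply/eqP; transitivity (0 : k).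
  apply/eqP; rewrite mcoeff_eq0.
  apply/negP => /msuppMP[u [v [mE /(gap _ _ fa) ua /gb vb]]].
  by move: mab; rewrite mE set_weightD => /eqP; rewrite gtn_eqF // -addSn leq_add.
apply/esym/eqP; rewrite oppr_eq0 mcoeff_eq0; apply/negP => /msuppMP[u [v [mE]]].
rewrite msupp_mfilter => /andP[/eqP ua _] /(gap _ _ gb) vb.
by move: mab; rewrite mE set_weightD ua => /eqP; rewrite eqn_add2l gtn_eqF.
Qed.

(* The ideal generated by the variables of F. *)
Definition var_prime F : {pred A} := fun f => weight_part F 0 f == 0.

Lemma var_primeP F f :
  reflect (forall m, m \in msupp f -> set_weight F m != 0%N) (f \in var_prime F).
Proof. by rewrite unfold_in mfilter_eq0; exact: allP. Qed.

(** The weight-0 part is multiplicative, as it sets the variables of F to zero, so the claim reduces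
    to A being a domain. *)
Lemma var_primeM F f g :
  (f * g \in var_prime F) = (f \in var_prime F) || (g \in var_prime F).
Proof.
rewrite /var_prime !unfold_in -mulf_eq0; congr (_ == 0); apply/mpolyP => m.
rewrite [LHS]mcoeff_mfilter; case: ifPn => [/eqP mF|mF].
  exact: mcoeff_weight_partM.
apply/esym/eqP; rewrite mcoeff_eq0; apply: contra mF => /msuppMP[u [v [->]]].
by rewrite !msupp_mfilter set_weightD => /andP[/eqP-> _] /andP[/eqP-> _].
Qed.

Lemma var_prime_zmod F : zmod_closed (var_prime F).
Proof.
split=> [|f g]; first by apply/var_primeP => m; rewrite msupp0.
by rewrite /var_prime !unfold_in /weight_part mfilterB => /eqP-> /eqP->; rewrite subrr.
Qed.

Lemma var_prime_proper F : 
  1 \notin var_prime F /\ forall f, {in var_prime F, forall g, f * g \in var_prime F}.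
Proof.
split=> [|f g gF]; last by rewrite var_primeM gF orbT.
apply/negP => /var_primeP/(_ 0%MM); rewrite msupp1 mem_head set_weight0.
by move=> /(_ isT).
Qed.

Lemma var_prime_prime F : prime_idealr_closed (var_prime F).
Proof. by move=> f g; rewrite var_primeM. Qed.

HB.instance Definition _ F := GRing.isZmodClosed.Build A (var_prime F)
  (var_prime_zmod F).
HB.instance Definition _ F := isProperIdeal.Build A (var_prime F)
  (var_prime_proper F).
HB.instance Definition _ F := isPrimeIdealrClosed.Build A (var_prime F)
  (@var_prime_prime F).

(* If s f lies in a monomial ideal, so does the product of the lowest part of f
   with a monomial of s outside the prime; remove that monomial from f and
   iterate. *)
Lemma var_prime_saturate F (J : ideal A) f s m : mon_closed J ->
    s \notin var_prime F -> s * f \in J -> m \in msupp f ->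
  exists2 u, set_weight F u = 0%N & ('X_[u + m] : A) \in J.
Proof.
move=> monJ; have [n] := ubnP (size (msupp f)); elim: n f s => // n IHn f s.
rewrite ltnS => szf sF sfJ mf.
have [r [v0 v0f v0r] minr] : exists2 r, (exists2 v, v \in msupp f & set_weight F v = r) &
    forall v, v \in msupp f -> (r <= set_weight F v)%N.
  have ex_r : exists r, has (fun v => set_weight F v == r) (msupp f).
    by exists (set_weight F m); apply/hasP; exists m.
  exists (ex_minn ex_r); case: ex_minnP => r /hasP[v vf /eqP vr] minr.
    by exists v.
  by move=> w wf; apply: minr; apply/hasP; exists w.
(* Both factors are nonzero in a domain, so some monomial u + v survives in the product; being of
   lowest weight, it also occurs in s f. *)
have : weight_part F 0 s * weight_part F r f != 0.
  apply: mulf_neq0; first exact sF.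
  rewrite mfilter_eq0; apply/allPn; exists v0 => //=.
  by rewrite v0r eqxx.
rewrite -msupp_eq0; case E: (msupp _) => [//|w ws] _.
have : w \in msupp (weight_part F 0 s * weight_part F r f) by rewrite E mem_head.
move=> w0; have [u [v [wE]]] := msuppMP w0.
rewrite !msupp_mfilter => /andP[/eqP u0 us] /andP[/eqP vr vf].
have uvJ : ('X_[u + v] : A) \in J.
  rewrite -wE; apply: (monJ _ _ sfJ); rewrite mcoeff_msupp.
  rewrite (mcoeff_weight_partM (F := F) (a := 0) (b := r)) -?mcoeff_msupp //.
  by rewrite wE set_weightD u0 vr.
have [mv|mNv] := eqVneq m v; first by exists u; rewrite // mv.
pose g : A := f - f@_v *: 'X_[v].
have gE : perm_eq (msupp g) (rem v (msupp f)) by exact: msupp_rem.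
(* The new multiplier absorbs the removed term: x^u s g is x^u (s f) minus a multiple of x^(u + v),
   both in J. It stays outside the prime since u has weight 0. *)
apply: (IHn g ('X_[u] * s)).
- by rewrite (perm_size gE) size_rem // prednK // -has_predT; apply/hasP; exists v.
- rewrite var_primeM negb_or sF andbT; apply/negP => /var_primeP/(_ u).
  by rewrite msuppX mem_head u0 => /(_ isT).
- rewrite /g -scaleNr mulrDr; apply: (rpredD (V := A^o)).
    by rewrite -mulrA; apply: (rpredZ (V := A^o)).
  rewrite -scalerAr scalerAl ['X_[u] * s]mulrC scalerAl -mulrA -mpolyXD.
  exact: (rpredZ (V := A^o)).
by rewrite (perm_mem gE) (rem_filter _ (msupp_uniq f)) mem_filter /= mNv.
Qed.
End VariablePrimes.

(** * Symbolic powers of a monomial ideal *)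

Section MonomialSymbolicPower.
Variables (k : fieldType) (d : nat).
Local Notation A := {mpoly k[d]}.
Implicit Types (m u v : 'X_{1..d}) (i j : 'I_d) (f g s : A) (F : {set 'I_d}).

Definition vars_in (P : prime_idealr A) : {set 'I_d} := [set i | ('X_i : A) \in P].

Lemma prime_monomial (P : prime_idealr A) m :
  ('X_[m] : A) \in P -> set_weight (vars_in P) m != 0%N.
Proof.
apply: contraTneq => m0; rewrite mpolyXE_id.
elim/big_rec: _ => [|i f _ fP]; first by rewrite idealr1.
rewrite prime_idealrM negb_or fP andbT.
have [iP|iP] := boolP (i \in vars_in P).
  suff -> : m i = 0%N by rewrite expr0 idealr1.
  by move/eqP: m0; rewrite set_weight_eq0 => /forall_inP/(_ i iP)/eqP.
elim: (m i) => [|n IHn]; first by rewrite expr0 idealr1.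
by rewrite exprS prime_idealrM negb_or IHn; rewrite inE in iP; rewrite iP.
Qed.

Lemma var_prime_min F (P : prime_idealr A) :
  F \subset vars_in P -> {subset var_prime F <= P}.
Proof.
move=> FP f /var_primeP fF; rewrite [f]mpolyE big_seq; apply: rpred_sum => m mf.
rewrite -mul_mpolyC; apply: idealMr.
have : set_weight F m != 0%N := fF m mf.
rewrite set_weight_eq0 negb_forall_in => /exists_inP[i iF mi].
have -> : m = ((m - U_(i)) + U_(i))%MM by rewrite submK // lep1mP.
rewrite mpolyXD; apply: idealMr.
by have := subsetP FP i iF; rewrite inE.
Qed.

Lemma vars_in_var_prime F : vars_in (var_prime F) = F.
Proof.
apply/setP => i; rewrite inE; apply/var_primeP/idP => [iF|iF m].
  have := iF U_(i)%MM; rewrite msuppX mem_head => /(_ isT).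
  rewrite set_weight_eq0 negb_forall_in => /exists_inP[j jF].
  by rewrite mnm1E; case: (eqVneq i j) => [->|_ /eqP[]].
rewrite msuppX inE => /eqP->; rewrite set_weight_eq0 negb_forall_in; apply/exists_inP.
by exists i; rewrite // mnm1E eqxx.
Qed.

Section Ideal.
Variables (I : ideal A) (monI : mon_closed I).

Lemma prime_over_monomial (P : prime_idealr A) :
  {subset I <= P} -> {subset I <= var_prime (vars_in P)}.
Proof.
by move=> IP f fI; apply/var_primeP => m mf; apply/prime_monomial/IP/(monI fI).
Qed.

(** The prime generated by the variables in P lies between I and P, so minimality forces
    equality. *)
Lemma minimal_primeE (P : prime_idealr A) :
  minimal_prime I P -> P =i var_prime (vars_in P).
Proof.
move=> [IP minP] f; apply/idP/idP; last exact: var_prime_min.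
apply: (minP (var_prime (vars_in P))); first exact: prime_over_monomial.
exact: var_prime_min.
Qed.

(** Only finitely many sets of variables compete, so a minimal one exists. The full set qualifies
    because 1 is not in I, and any prime over I inside [var_prime F] contains the prime generated by
    its own variables. *)
Lemma exists_minimal_prime : (1 : A) \notin I -> exists P, minimal_prime I P.
Proof.
move=> I1; pose over F := `[< {subset I <= var_prime F} >].
have overT : over setT.
  apply/asboolP => f fI; apply/var_primeP => m mf; apply: contra I1.
  rewrite set_weight_eq0 => /forall_inP m0; have := monI fI mf.
  suff -> : m = 0%MM by rewrite mpolyX0.
  by apply/mnmP => i; rewrite mnm0E; apply/eqP/m0.
have [F /minsetP[/asboolP IF minF] _] := minset_exists overT.
exists (var_prime F); split=> // P IP PF; apply: var_prime_min.
rewrite (minF (vars_in P)) //; first exact/asboolP/prime_over_monomial.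
by apply/subsetP => i; rewrite inE => /PF iF; rewrite -[F]vars_in_var_prime inE.
Qed.

Lemma symbolic_power_sub_pred n :
  {subset symbolic_power I n <= symbolic_power I n.-1}.
Proof.
move=> f /mem_symbolic_power fI; apply/mem_symbolic_power => P minP.
have [s sP sfI] := fI P minP; exists s => //; exact: ideal_pow_sub_pred.
Qed.

Lemma symbolic_power_saturate n f m P :
    f \in symbolic_power I n -> m \in msupp f -> minimal_prime I P ->
  exists u, [/\ set_weight (vars_in P) u = 0%N, ('X_[u] : A) \notin P
    & ('X_[u + m] : A) \in ideal_pow I n].
Proof.
move=> /mem_symbolic_power fI mf minP; have [s sP sfI] := fI P minP.
rewrite (minimal_primeE minP) in sP.
have [u u0 umI] := var_prime_saturate (mon_closed_ideal_pow monI (n := n)) sP sfI mf.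
exists u; split=> //; rewrite (minimal_primeE minP); apply/negP => /var_primeP/(_ u).
by rewrite msuppX mem_head u0 => /(_ isT).
Qed.

Lemma mon_closed_symbolic_power n : mon_closed (symbolic_power I n).
Proof.
move=> f m fI mf; apply/mem_symbolic_power => P minP.
have [u [_ uP umI]] := symbolic_power_saturate fI mf minP.
by exists 'X_[u]; rewrite // -mpolyXD.
Qed.

Lemma symbolic_power_divX n m j : ('X_[m] : A) \in symbolic_power I n ->
  (0 < m j)%N -> ('X_[(m - U_(j))%MM] : A) \in symbolic_power I n.-1.
Proof.
move=> mI mj; apply/mem_symbolic_power => P minP.
have [|u [_ uP umI]] := symbolic_power_saturate mI (m := m) _ minP.
  by rewrite msuppX mem_head.
exists 'X_[u] => //; rewrite -mpolyXD.
have -> : (u + (m - U_(j)) = u + m - U_(j))%MM.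
  by rewrite addmBA // lep1mP -lt0n.
by apply: ideal_pow_divX umI _; rewrite // mnmDE addn_gt0 mj orbT.
Qed.

(** A nonzero constant term would put some monomial outside a minimal prime P into I^n, hence into I
    and into P. *)
Lemma symbolic_power_mcoeff0 n f : (1 : A) \notin I -> (0 < n)%N ->
  f \in symbolic_power I n -> f@_0 = 0.
Proof.
move=> I1 n0 fI; apply/eqP; apply: contraT; rewrite -mcoeff_msupp => f0.
have [P minP] := exists_minimal_prime I1.
have [u [_ uP]] := symbolic_power_saturate fI f0 minP.
rewrite addm0 => /(ideal_pow_sub n0) uI.
by rewrite (minP.1 _ uI) in uP.
Qed.

Lemma symbolic_power_mdivX n (p : 'I_d) f :
  f \in symbolic_power I n -> mdivX p f \in symbolic_power I n.-1.
Proof.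
move=> fI; apply: mon_closed_sum => m mf /andP[_ mp].
by apply: symbolic_power_divX => //; apply: mon_closed_symbolic_power mf.
Qed.
End Ideal.
End MonomialSymbolicPower.

Theorem proposition5p10 (k : fieldType) (d : nat) (I : ideal {mpoly k[d]})
    (monI : monomial_ideal I)
    (nzI : exists2 f : {mpoly k[d]}, f \in I & f != 0)
    (propI : (1 : {mpoly k[d]}) \notin I) :
  (forall n : nat, (1 <= n)%N ->
     {subset dstar (symbolic_power I n) <= symbolic_power I n.-1}) /\
  Tor_vanishing (residue_module k d) (fun n => symbolic_power I n).
Proof.
have mcI := monomial_ideal_closed monI.
split=> [n n_gt0|n n_gt0].
  apply: (span_sub (S := symbolic_power I n.-1)) => g [G [m [i [[GI _] Gm gX]]]].
  have mI : ('X_[m] : {mpoly k[d]}) \in symbolic_power I n.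
    by rewrite GI; apply: mem_span; exists m.
  (* The coefficient of g x_i at m is 1, whereas it would be 0 if x_i did not divide the
     monomial. *)
  have mi : (0 < m i)%N.
    have := congr1 (mcoeff m) gX; rewrite mulrC mcoeffXUM mcoeffX eqxx.
    by case: ifP => // _ /esym/eqP; rewrite oner_eq0.
  suff -> : g = 'X_[(m - U_(i))%MM] by apply: symbolic_power_divX.
  have Xi0 : ('X_i : {mpoly k[d]}) != 0 by rewrite -msupp_eq0 msuppX.
  by apply: (mulIf Xi0); rewrite gX -mpolyXD submK // lep1mP -lt0n.
exists (@symbolic_power_sub_pred k d I n) => i P.
apply: tor_null_Tor_map.
apply: (@tor_null_resolution _ _ _ _ _ P (koszul_resolution k d)).
apply: koszul_tor_null => [f|p f]; first exact: symbolic_power_mcoeff0.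
exact: symbolic_power_mdivX.
Qed.
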